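(* Let $p$ be a prime, let $n,i\in\mathbb{N}$ with $i\mid n$, and let $q=p^n$. Let $D=\mathbb{D}(\mathrm{GF}(q))$ be the ring of dual numbers over $\mathrm{GF}(q)$, let $\mathbb{P}(D)$ be the projective line over $D$ with its parallelism relation, and let $\Gamma(D)$ be the projective group of $\mathbb{P}(D)$ (all notions as defined in the context). Then for each row of the following list, whenever the stated condition on $p$ and $i$ holds, there exists a $3$-$(q,k,\lambda_3)$-divisible design with $q(q+1)$ points (point set $\mathbb{P}(D)$, point classes the parallel classes) with the given $k$ and $\lambda_3$, which admits $\Gamma(D)$ as a point-transitive and block-transitive automorphism group: (i) $k=p^i+1$, $\lambda_3=1$ (no further condition); (ii) $k=p^i$, $\lambda_3=p^i-2$, provided $p^i>2$; (iii) $k=p^i-1$, $\lambda_3=\frac12(p^i-2)(p^i-3)$, provided $p^i>3$; (iv) $k=p^i-2$, $\lambda_3=\frac16(p^i-2)(p^i-3)(p^i-4)$, provided $p^i>4$; (v) provided $p^i>7$: $k=p^i-3$, $\lambda_3=\frac14(p^i-3)(p^i-4)(p^i-5)$, and also $k=4$, $\lambda_3=6$; provided $p=3$ and $p^i>5$: $k=p^i-3$, $\lambda_3=\frac1{24}(p^i-3)(p^i-4)(p^i-5)$, and also $k=4$, $\lambda_3=1$; provided $p>3$ and $p^i>5$: $k=p^i-3$, $\lambda_3=\frac18(p^i-3)(p^i-4)(p^i-5)$, and also $k=4$, $\lambda_3=3$; provided $p^i\equiv 1 \pmod 3$ and $p^i>5$: $k=p^i-3$, $\lambda_3=\frac1{12}(p^i-3)(p^i-4)(p^i-5)$,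 and also $k=4$, $\lambda_3=2$. Moreover, the same holds for the corresponding $2$-divisible designs, i.e. each of these designs, regarded as a $2$-$(q,k,\lambda_2)$-divisible design with $\lambda_2=\lambda_3\,q(q-1)/(k-2)$, also admits $\Gamma(D)$ as a point- and block-transitive automorphism group.
   Context: Divisible designs: let $X$ be a finite set with an equivalence relation $R$; $[x]$ denotes the class of $x$ and $S=\{[x]:x\in X\}$. A subset $Y\subseteq X$ is $R$-transversal if $|Y\cap[x]|\le 1$ for all $x\in X$. For positive integers $t\le k<v=|X|$, $s$, $\lambda_t$, a triple $(X,\mathcal{B},S)$ is a $t$-$(s,k,\lambda_t)$-divisible design if: every $B\in\mathcal{B}$ is an $R$-transversal subset with $|B|=k$; $|[x]|=s$ for all $x$; and every $R$-transversal $t$-subset of $X$ is contained in exactly $\lambda_t$ blocks. Designs are assumed simple (no repeated blocks). An automorphism is a permutation of $X$ preserving $R$ and mapping blocks to blocks. Dual numbers: $D=\mathbb{D}(\mathrm{GF}(q))=\{a+b\epsilon: a,b\in\mathrm{GF}(q)\}$ with $\epsilon^2=0$, i.e. $(a,b)+(a',b')=(a+a',b+b')$, $(a,b)(a',b')=(aa',ab'+ba')$; it is a commutative local ring with group of units $\mathcal{R}=\{a+b\epsilon:a\neq 0\}$. Projective line: a pair $(x_1,x_2)\in D^2$ is admissible if at least one of $x_1,x_2$ is a unit; $\mathbb{P}(D)$ is the set of classes $\mathcal{R}(x_1,x_2)$ of admissible pairs under $(x_1,x_2)\sim(rx_1,rx_2)$, $r\in\mathcal{R}$. It has $q^2+q$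 points. Two points $\mathcal{R}(p_1,p_2)$, $\mathcal{R}(q_1,q_2)$ are parallel if $p_1q_2-q_1p_2\notin\mathcal{R}$; this is an equivalence relation with $q+1$ classes of $q$ points each. Projective group: $\Gamma(D)$ is the group of invertible $2\times 2$ matrices over $D$ modulo the scalar matrices $rI$, $r\in\mathcal{R}$, acting on $\mathbb{P}(D)$ by $\mathcal{R}(x_1,x_2)\mapsto\mathcal{R}((x_1,x_2)M)$; it preserves parallelism. *)

(* Defs.v *)
From HB Require Import structures.
From mathcomp Require Import all_boot all_order all_algebra all_fingroup.

Set Implicit Arguments.
Unset Strict Implicit.
Unset Printing Implicit Defensive.

Import GRing.Theory.
Local Open Scope ring_scope.

Section DivisibleDesigns.
Variables (X : finType) (R : rel X).

Definition transversal_set (Y : {set X}) : bool :=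
  [forall x, #|Y :&: [set y | R x y]| <= 1]%N.

(* The classes of [R] are the point classes, and designs are simple because
   [B] is a set of sets. *)
Record divisible_design (t s k lam : nat) (B : {set {set X}}) : Prop :=
  DivisibleDesign {
    dd_equiv : equivalence_rel R;
    dd_params : [/\ 0 < t, t <= k, k < #|X|, 0 < s & 0 < lam]%N;
    dd_blocks : forall b, b \in B -> transversal_set b /\ #|b| = k;
    dd_classes : forall x, #|[set y | R x y]| = s;
    dd_balanced : forall Y : {set X}, transversal_set Y -> #|Y| = t ->
      #|[set b in B | Y \subset b]| = lam
  }.

Definition design_automorphism (B : {set {set X}}) (f : {perm X}) : Prop :=
  (forall x y, R (f x) (f y) = R x y) /\ (forall b, b \in B -> f @: b \in B).

(* Faithfulness is what makes [G] itself, rather than a quotient of it, a group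
   of automorphisms. *)
Definition automorphism_group (gT : finGroupType) (A : {set gT})
    (to : action A X) (G : {set gT}) (B : {set {set X}}) : Prop :=
  [/\ G \subset A, [faithful G, on [set: X] | to]
    & forall g, g \in G -> design_automorphism B (actperm to g)].

End DivisibleDesigns.

(* [Dual a b] stands for a + b * epsilon, where epsilon ^+ 2 = 0. *)
Record dual (F : Type) := Dual { dre : F; deps : F }.

Definition pair_of_dual F (x : dual F) := (dre x, deps x).
Definition dual_of_pair F (x : F * F) := Dual x.1 x.2.
Lemma pair_of_dualK F : cancel (@pair_of_dual F) (@dual_of_pair F).
Proof. by case. Qed.

HB.instance Definition _ (F : eqType) :=
  Equality.copy (dual F) (can_type (@pair_of_dualK F)).
HB.instance Definition _ (F : choiceType) :=
  Choice.copy (dual F) (can_type (@pair_of_dualK F)).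
HB.instance Definition _ (F : countType) :=
  Countable.copy (dual F) (can_type (@pair_of_dualK F)).
HB.instance Definition _ (F : finType) :=
  Finite.copy (dual F) (can_type (@pair_of_dualK F)).

Section DualRing.
Variable F : fieldType.
Implicit Types x y z : dual F.

Definition dual_zero : dual F := Dual 0 0.
Definition dual_one : dual F := Dual 1 0.
Definition dual_opp x := Dual (- dre x) (- deps x).
Definition dual_add x y := Dual (dre x + dre y) (deps x + deps y).
Definition dual_mul x y :=
  Dual (dre x * dre y) (dre x * deps y + deps x * dre y).

Lemma dual_addA : associative dual_add.
Proof. by move=> [a b] [c d] [e f]; rewrite /dual_add /= !addrA. Qed.
Lemma dual_addC : commutative dual_add.
Proof.
by move=> [a b] [c d]; rewrite /dual_add /= [a + _]addrC [b + _]addrC.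
Qed.
Lemma dual_add0 : left_id dual_zero dual_add.
Proof. by move=> [a b]; rewrite /dual_add /= !add0r. Qed.
Lemma dual_addN : left_inverse dual_zero dual_opp dual_add.
Proof. by move=> [a b]; rewrite /dual_add /= !addNr. Qed.

HB.instance Definition _ :=
  GRing.isZmodule.Build (dual F) dual_addA dual_addC dual_add0 dual_addN.

Lemma dual_mulA : associative dual_mul.
Proof.
move=> [a b] [c d] [e f]; rewrite /dual_mul /= mulrA; congr Dual.
by rewrite mulrDr mulrDl !mulrA addrA.
Qed.
Lemma dual_mulC : commutative dual_mul.
Proof.
move=> [a b] [c d]; rewrite /dual_mul /= mulrC; congr Dual.
by rewrite addrC mulrC [a * d]mulrC.
Qed.
Lemma dual_mul1 : left_id dual_one dual_mul.
Proof. by move=> [a b]; rewrite /dual_mul /= !mul1r mul0r addr0. Qed.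
Lemma dual_mulDl : left_distributive dual_mul (@GRing.add (dual F)).
Proof.
move=> [a b] [c d] [e f]; rewrite /dual_mul /=; congr Dual => /=.
  by rewrite mulrDl.
by rewrite !mulrDl addrACA.
Qed.
Lemma dual_oner_neq0 : dual_one != 0.
Proof. by apply/eqP => -[] /eqP; rewrite oner_eq0. Qed.

HB.instance Definition _ :=
  GRing.Zmodule_isComNzRing.Build (dual F)
    dual_mulA dual_mulC dual_mul1 dual_mulDl dual_oner_neq0.

Definition dual_unit : {pred dual F} := fun x => dre x != 0.
Definition dual_inv x :=
  if dual_unit x then Dual (dre x)^-1 (- deps x / dre x ^+ 2) else x.

Lemma dual_mulVr : {in dual_unit, left_inverse 1 dual_inv *%R}.
Proof.
move=> [a b]; rewrite /dual_inv unfold_in /dual_unit /= => a0; rewrite a0.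
congr Dual => /=; first by rewrite mulVf.
by rewrite expr2 invfM mulNr mulNr -!mulrA mulVf // mulr1 [b * _]mulrC subrr.
Qed.
Lemma dual_unitP x y : y * x = 1 -> dual_unit x.
Proof.
case: x y => [a b] [c d] [] + _; rewrite /dual_unit /= => ca1.
by apply/eqP => a0; move/eqP: ca1; rewrite a0 mulr0 eq_sym oner_eq0.
Qed.
Lemma dual_invr_out : {in [predC dual_unit], dual_inv =1 id}.
Proof.
move=> x; rewrite /dual_inv; case: ifP => // u.
by rewrite !inE [x \in _]u.
Qed.

HB.instance Definition _ :=
  GRing.ComNzRing_hasMulInverse.Build (dual F)
    dual_mulVr dual_unitP dual_invr_out.

Lemma dual_unitE x : (x \is a GRing.unit) = (dre x != 0).
Proof. by []. Qed.

Lemma dre_is_zmod_morphism : zmod_morphism (@dre F).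
Proof. by []. Qed.
HB.instance Definition _ :=
  GRing.isZmodMorphism.Build (dual F) F (@dre F) dre_is_zmod_morphism.

End DualRing.

HB.instance Definition _ (F : finFieldType) := GRing.ComUnitRing.on (dual F).
Definition dual_ring (F : finFieldType) : finComUnitRingType := dual F.

Section ProjectiveLine.
Variable F : finFieldType.
Local Notation D := (dual_ring F).
Implicit Types (x y : 'rV[D]_2) (M : {'GL_2[D]}).

Definition admissible x : bool :=
  (x 0 0 \is a GRing.unit) || (x 0 1 \is a GRing.unit).

Definition unit_class x : {set 'rV[D]_2} :=
  [set r *: x | r : D & r \is a GRing.unit].

Definition is_point (P : {set 'rV[D]_2}) : bool :=
  [exists x, admissible x && (P == unit_class x)].

Definition point : finType := {P : {set 'rV[D]_2} | is_point P}.

(* Whether the determinant is a unit does not depend on the representatives;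
   see [parallelE]. *)
Definition parallel (P Q : point) : bool :=
  [exists x in val P, exists y in val Q,
     x 0 0 * y 0 1 - y 0 0 * x 0 1 \isn't a GRing.unit].

Lemma unit_class_is_point x : admissible x -> is_point (unit_class x).
Proof. by move=> hx; apply/existsP; exists x; rewrite hx eqxx. Qed.

Definition mkpoint x (hx : admissible x) : point :=
  exist _ (unit_class x) (unit_class_is_point hx).

Lemma pointP (P : point) : exists x, exists hx : admissible x, P = mkpoint hx.
Proof.
have /existsP[x /andP[hx /eqP eP]] := valP P.
by exists x, hx; apply: val_inj.
Qed.

Lemma parallelE x y (hx : admissible x) (hy : admissible y) :
  parallel (mkpoint hx) (mkpoint hy)
  = (x 0 0 * y 0 1 - y 0 0 * x 0 1 \isn't a GRing.unit).
Proof.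
have mem1 z : z \in unit_class z.
  by apply/imsetP; exists 1; rewrite ?inE ?unitr1 ?scale1r.
apply/existsP/idP => [[x' /andP[/imsetP[r ur ->]]]|nu]; last first.
  exists x; rewrite mem1 /=; apply/existsP; exists y.
  by rewrite mem1 nu.
case/existsP => y' /andP[/imsetP[s us ->]]; apply: contra => u.
rewrite inE in ur; rewrite inE in us.
rewrite !mxE mulrACA [X in _ - X]mulrACA [s * r]mulrC -mulrBr.
by rewrite !unitrM ur us u.
Qed.

Lemma imset_unit_class x M :
  [set y *m GLval M | y in unit_class x] = unit_class (x *m GLval M).
Proof.
rewrite /unit_class -imset_comp; apply: eq_imset => r /=.
by rewrite scalemxAl.
Qed.

Lemma admissible_mulmx x M : admissible x -> admissible (x *m GLval M).
Proof.
have key y (N : 'M[D]_2) j : ~~ admissible y -> dre ((y *m N) 0 j) = 0.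
  rewrite negb_or !dual_unitE !negbK => /andP[/eqP y0 /eqP y1].
  rewrite mxE big_ord_recl big_ord1 raddfD /=.
  by rewrite (_ : lift ord0 ord0 = 1) ?y0 ?y1 ?mul0r ?addr0 //; apply: val_inj.
apply: contraLR => nadm.
rewrite -(mulmxK (GL_unitmx M) x).
by rewrite negb_or !dual_unitE !negbK !key ?eqxx.
Qed.

Lemma point_act_proof (P : point) M :
  is_point [set y *m GLval M | y in val P].
Proof.
have [x [hx ->]] := pointP P; rewrite /= imset_unit_class.
exact/unit_class_is_point/admissible_mulmx.
Qed.

Definition point_act (P : point) M : point :=
  exist _ [set y *m GLval M | y in val P] (point_act_proof P M).

Lemma point_act_mkpoint x (hx : admissible x) M :
  point_act (mkpoint hx) M = mkpoint (admissible_mulmx M hx).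
Proof. by apply: val_inj; rewrite /= imset_unit_class. Qed.

Lemma point_act1 : point_act^~ 1%g =1 id.
Proof.
move=> P; apply: val_inj => /=; rewrite -[RHS]imset_id.
by apply: eq_imset => y; apply: mulmx1.
Qed.

Lemma point_actM P : act_morph point_act P.
Proof.
move=> M N; apply: val_inj => /=; rewrite -imset_comp.
by apply: eq_imset => y /=; apply: mulmxA.
Qed.

Canonical point_action : {action {'GL_2[D]} &-> point} :=
  TotalAction point_act1 point_actM.

Definition scalars : {set {'GL_2[D]}} :=
  [set M : {'GL_2[D]} |
     [exists r : D, (r \is a GRing.unit) && (GLval M == r%:M)]].

Lemma scalars_group_set : group_set scalars.
Proof.
apply/group_setP; split=> [|M N]; rewrite ?inE.
  by apply/existsP; exists 1; rewrite unitr1 GL_1E eqxx.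
case/existsP => r /andP[ur /eqP eM] /existsP[s /andP[us /eqP eN]].
apply/existsP; exists (r * s).
by rewrite unitrM ur us GL_MxE eM eN -scalar_mxM eqxx.
Qed.
Canonical scalars_group := Group scalars_group_set.

Definition projective_group : {group coset_of scalars} :=
  ('GL_2[D] / scalars)%G.

(* The range restriction built into [_ %% _] is harmless here, since scalars
   fix all points; see [projective_actE]. *)
Definition projective_action : action ('GL_2[D] / scalars)%g point :=
  (point_action %% scalars)%act.

Lemma scalars_norm M : M \in 'N(scalars)%g.
Proof.
apply: (subsetP (cent_sub _)); apply/centP => N.
rewrite inE => /existsP[r /andP[_ /eqP eN]].
apply: val_inj; rewrite [LHS]GL_MxE [RHS]GL_MxE eN.
by rewrite mul_mx_scalar mul_scalar_mx.
Qed.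

Lemma projective_actE x (hx : admissible x) M :
  projective_action (mkpoint hx) (coset scalars M)
  = mkpoint (admissible_mulmx M hx).
Proof.
rewrite -point_act_mkpoint /projective_action /= modactE ?in_setT ?scalars_norm //.
apply/afixP => N; rewrite !inE /= => /existsP[r /andP[ur /eqP eN]].
rewrite /= point_act_mkpoint; apply: val_inj => /=.
rewrite eN mul_mx_scalar; apply/setP => y; apply/imsetP/imsetP.
  case=> s; rewrite inE => us ->; exists (s * r); last by rewrite scalerA.
  by rewrite inE unitrM us.
case=> s; rewrite inE => us ->; exists (s / r).
  by rewrite inE unitrM us unitrV.
by rewrite scalerA divrK.
Qed.

End ProjectiveLine.

(* The parameter lam is rational so that fractions in its formulas are exact
   divisions.  The two clauses regard the same blocks as a 3-design and as a
   2-design; by double counting, lam2 = lam * q * (q - 1) / (k - 2). *)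
Definition projective_design (F : finFieldType) (k : nat) (lam : rat)
    (B : {set {set point F}}) : Prop :=
  let q := #|F| in
  (exists2 lam3 : nat, lam3%:R = lam
     & divisible_design (@parallel F) 3 q k lam3 B) /\
  (exists2 lam2 : nat, lam2%:R = lam * (q%:R * (q%:R - 1)) / (k%:R - 2)
     & divisible_design (@parallel F) 2 q k lam2 B).

Definition admits_projective_group (F : finFieldType)
    (B : {set {set point F}}) : Prop :=
  [/\ automorphism_group (@parallel F) (projective_action F)
        (projective_group F) B,
      [transitive projective_group F, on [set: point F] | projective_action F]
    & [transitive projective_group F, on B | (projective_action F)^*]].

Definition exists_projective_design (F : finFieldType) (k : nat) (lam : rat)
    : Prop :=
  exists2 B : {set {set point F}},
    projective_design k lam B & admits_projective_group B.

(* Main.v *)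
Require Import Defs.
From HB Require Import structures.
From mathcomp Require Import all_boot all_order all_algebra all_fingroup.
From mathcomp Require Import all_field ring zify.

(* The group PGL_2(D) acts sharply transitively on the triples of pairwise
   non-parallel points. Hence the orbit of a transversal k-set S is a 3-design
   with lambda_3 = k (k - 1) (k - 2) / |Stab S|, and everything reduces to the
   order of stabilisers. The blocks are built from a circle L, the projective
   line over the subfield with m = p^i elements, which is determined by any three
   of its points: S is L minus a set T of at most three points, or T itself or
   L minus T for the four-set T = {infinity, 0, 1, c}. When |T| <= 3, Stab S is
   the stabiliser of T in Stab L, which permutes the subsets of L of the size of T
   transitively; when |T| = 4, Stab S = Stab T, which is transitive on T by the
   Klein four-group, and the elements fixing infinity are the affine maps that
   permute 0, 1, c; there are 1, 2, 6 or 3 of them according to c. *)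

Set Implicit Arguments.
Unset Strict Implicit.
Unset Printing Implicit Defensive.

(** * Sharply 3-transitive groups and divisible designs *)

Section Transversal.
Variables (X : finType) (R : rel X).
Hypothesis R_equiv : equivalence_rel R.
Implicit Types (Y Z : {set X}) (B : {set {set X}}).

Definition transversal_seq (t : seq X) : bool :=
  pairwise [rel x y | ~~ R x y] t.

Lemma equiv_refl : reflexive R.
Proof. by move=> x; have [] := R_equiv x x x. Qed.

Lemma equiv_sym : symmetric R.
Proof.
move=> x y; apply/idP/idP => xy.
  by have [_ <-] := R_equiv x y x; rewrite ?equiv_refl.
by have [_ <-] := R_equiv y x y; rewrite ?equiv_refl.
Qed.

Lemma equiv_transl x y : R x y -> R x =1 R y.
Proof. by move=> xy z; have [_ ->] := R_equiv x y z. Qed.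

Lemma transversal_setP Y :
  reflect {in Y &, forall x y, R x y -> x = y} (transversal_set R Y).
Proof.
apply: (iffP forallP) => [trY x y xY yY Rxy | trY x].
  move/card_le1_eqP: (trY x); apply; by rewrite !inE ?xY ?yY ?equiv_refl.
apply/card_le1_eqP => y z; rewrite !inE => /andP[yY xy] /andP[zY xz].
by apply: trY => //; rewrite -(equiv_transl xz).
Qed.

Lemma transversal_setS Y Z :
  Y \subset Z -> transversal_set R Z -> transversal_set R Y.
Proof.
move=> /subsetP YZ /transversal_setP trZ; apply/transversal_setP => x y xY yY.
by apply: trZ; apply: YZ.
Qed.

Lemma transversal_seq_uniq t : transversal_seq t -> uniq t.
Proof.
elim: t => //= x t IH /andP[xt /IH ->]; rewrite andbT.
by apply/negP => /(allP xt) /=; rewrite equiv_refl.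
Qed.

Lemma sub_transversal_seq Y (t : seq X) :
  transversal_set R Y -> uniq t -> {subset t <= Y} -> transversal_seq t.
Proof.
move=> /transversal_setP trY; elim: t => //= x t IH /andP[xt ut] tY.
rewrite IH // => [|y yt]; last by apply: tY; rewrite inE yt orbT.
rewrite andbT; apply/allP => y yt /=; apply: contra xt => Rxy.
by rewrite (trY x y) // tY // inE ?eqxx ?yt ?orbT.
Qed.

(** Double counting of the pairs of a block through a transversal 2-set [Y] and a further point of
    it. The block [b0] supplies a transversal 2-set, from which [lam2] is read off; [2 * s < #|X|]
    makes [lam2] positive. *)
Lemma divisible_design2 s k lam3 B b0 :
  divisible_design R 3 s k lam3 B -> b0 \in B -> 2 * s < #|X| ->
  exists2 lam2, lam2 * (k - 2) = lam3 * (#|X| - 2 * s)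
    & divisible_design R 2 s k lam2 B.
Proof.
case=> _ [_ k3 kX s0 l0] blk cls bal b0B sX.
have count Y : transversal_set R Y -> #|Y| = 2 ->
    #|[set b in B | Y \subset b]| * (k - 2) = lam3 * (#|X| - 2 * s).
  (* [W] consists of the points that extend [Y] to a transversal triple: all points outside the two
     classes that meet [Y]. *)
  move=> trY cY; pose W := [set z | [forall y in Y, ~~ R y z]].
  have cW : #|W| = #|X| - 2 * s.
    have /cards2P[y [y' [yy' eY]]] : #|Y| == 2 by rewrite cY.
    have -> : W = ~: ([set z | R y z] :|: [set z | R y' z]).
      apply/setP => z; rewrite !inE negb_or.
      apply/forall_inP/andP => [h|[h h'] u].
        by rewrite !h // eY !inE eqxx ?orbT.
      by rewrite eY !inE => /orP[] /eqP ->.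
    rewrite cardsCs setCK cardsU !cls (_ : _ :&: _ = set0) ?cards0.
      by rewrite subn0 mul2n addnn.
    apply/setP => z; rewrite !inE; apply/negP => /andP[yz y'z].
    move/transversal_setP: trY => /(_ y y'); rewrite eY !inE !eqxx orbT.
    move=> /(_ isT isT) h; rewrite h ?eqxx // in yy'.
    by rewrite (equiv_transl yz) equiv_sym.
  have yW y : y \in Y -> y \in W = false.
    by move=> yY; rewrite inE; apply/forall_inP => /(_ _ yY); rewrite equiv_refl.
  rewrite -sum_nat_const.
  transitivity (\sum_(b in [set b in B | Y \subset b])
                  \sum_(z in W) (z \in b : nat)).
    apply: eq_bigr => b; rewrite inE => /andP[bB Yb].
    have [trb cb] := blk b bB.
    have <- : #|b :\: Y| = k - 2 by rewrite cardsD (setIidPr Yb) cb cY.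
    rewrite -big_mkcondr /= sum1dep_card.
    apply: eq_card => z; rewrite !inE; case zb: (z \in b); rewrite !(andbF, andbT) //.
    apply/idP/forall_inP => [zY y yY | h]; last first.
      by apply/negP => zY; move: (h z zY); rewrite equiv_refl.
    apply: contra zY => Ryz; move/transversal_setP: trb => /(_ y z) <- //.
    exact: (subsetP Yb).
  rewrite exchange_big /= -cW mulnC -sum_nat_const; apply: eq_bigr => z zW.
  rewrite -(bal (z |: Y)); first last.
  - by rewrite cardsU1 cY; case zY: (z \in Y) => //; rewrite yW in zW.
  - apply/transversal_setP => x y.
    move: zW; rewrite inE => /forall_inP zW.
    rewrite !inE => /predU1P[->|xY] /predU1P[->|yY] // Rxy.
    + by case/negP: (zW _ yY); rewrite equiv_sym.
    + by case/negP: (zW _ xY).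
    + by move/transversal_setP: trY; apply.
  rewrite -big_mkcondr /= sum1dep_card; apply: eq_card => b.
  by rewrite !inE subUset sub1set -andbA [(Y \subset b) && _]andbC.
have [trb cb] := blk b0 b0B.
have [Y Yb cY] : exists2 Y : {set X}, Y \subset b0 & #|Y| = 2.
  have: 0 < #|[set A : {set X} | A \subset b0 & #|A| == 2]|.
    by rewrite cards_draws bin_gt0 cb ltnW.
  by case/card_gt0P => Y; rewrite inE => /andP[Yb /eqP]; exists Y.
have trY := transversal_setS Yb trb.
have k2 : 0 < k - 2 by rewrite subn_gt0.
exists #|[set b in B | Y \subset b]|; first exact: count.
(* [count] has the same right-hand side for every transversal 2-set, so cancelling [k - 2] shows
   that the number of blocks is constant. *)
split=> // [|Z trZ cZ]; last first.
  by apply/eqP; rewrite -(eqn_pmul2r k2) !count.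
split=> //; first exact: ltnW.
apply: contraT; rewrite -eqn0Ngt => /eqP c0; have := count Y trY cY.
by rewrite c0 mul0n => /esym/eqP; rewrite muln_eq0 subn_eq0 leqNgt sX orbF -leqn0 leqNgt l0.
Qed.

End Transversal.

(** * Orbits of a sharply 3-transitive group as designs, and stabilisers of circles *)

Section SharplyTransitive.
Variables (X : finType) (R : rel X) (gT : finGroupType) (G : {group gT}).
Variables (to : action G X) (o : 3.-tuple X).
Hypothesis R_equiv : equivalence_rel R.
Hypothesis R_act : forall g, g \in G -> forall x y, R (to x g) (to y g) = R x y.
Hypothesis o_transversal : transversal_seq R o.
Hypothesis G_trans : forall t : 3.-tuple X, transversal_seq R t ->
  exists2 g, g \in G & map (to^~ g) o = t.
Hypothesis G_free : forall g, g \in G -> map (to^~ g) o = o -> g = 1%g.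
Implicit Types (Y L T S : {set X}) (t : 3.-tuple X) (g h : gT).

Local Notation stab S := ('N(S | to)%g).
Local Notation transversal_seq := (transversal_seq R).
Local Notation transversal_set := (transversal_set R).

Lemma map_actM (t : seq X) g h : g \in G -> h \in G ->
  map (to^~ (g * h)%g) t = map (to^~ h) (map (to^~ g) t).
Proof.
by move=> gG hG; rewrite -map_comp; apply: eq_map => x /=; rewrite actMin.
Qed.

Lemma map_actK (t : seq X) g : g \in G ->
  map (to^~ g^-1%g) (map (to^~ g) t) = t.
Proof.
by move=> gG; rewrite -map_comp -[RHS]map_id; apply: eq_map => x /=; rewrite actKin.
Qed.

Lemma sharp_trans t t' : transversal_seq t -> transversal_seq t' ->
  exists2 g, g \in G & map (to^~ g) t = t'.
Proof.
move=> /G_trans[g gG <-] /G_trans[h hG <-].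
exists (g^-1 * h)%g; first by rewrite groupM ?groupV.
by rewrite map_actM ?groupV // map_actK.
Qed.

Lemma sharp_inj t g h : transversal_seq t -> g \in G -> h \in G ->
  map (to^~ g) t = map (to^~ h) t -> g = h.
Proof.
move=> /G_trans[a aG <-] gG hG.
rewrite -!map_actM // => e.
have: (a * g * (a * h)^-1 = 1)%g.
  apply: G_free; first by rewrite groupM ?groupV ?groupM.
  by rewrite map_actM ?groupV ?groupM // e map_actK // groupM.
by move/eqP; rewrite -eq_mulgV1 => /eqP /mulgI.
Qed.

Lemma map_act_transversal (t : seq X) g :
  g \in G -> transversal_seq (map (to^~ g) t) = transversal_seq t.
Proof.
move=> gG; rewrite /transversal_seq pairwise_map.
by apply: eq_pairwise => x y /=; rewrite R_act.
Qed.

Lemma card_set_tuple Y : #|Y| = 3 -> exists t, t =i Y.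
Proof.
move=> cY; have sz : size (enum Y) == 3 by rewrite -cardE cY.
by exists (Tuple sz) => x; rewrite mem_enum.
Qed.

Lemma sub_tuple Y : 2 < #|Y| -> exists2 t : 3.-tuple X, uniq t & {subset t <= Y}.
Proof.
move=> cY; have sz : size (take 3 (enum Y)) == 3.
  by rewrite size_takel // -cardE.
exists (Tuple sz) => /=; first by rewrite take_uniq ?enum_uniq.
by move=> x /mem_take; rewrite mem_enum.
Qed.

(** An element is determined by the image of the frame [t], and every triple of distinct points of
    [Y] is such an image; the elements thus correspond to the injective triples in [Y]. *)
Lemma card_move_into t Y : transversal_seq t -> transversal_set Y ->
  #|[set g in G | all [in Y] (map (to^~ g) t)]| = #|Y| ^_ 3.
Proof.
move=> trt trY; rewrite -card_uniq_tuples.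
rewrite -(card_in_imset (f := fun g => map_tuple (to^~ g) t)); last first.
  move=> g h; rewrite !inE => /andP[gG _] /andP[hG _] /(congr1 val) /=.
  exact: sharp_inj.
apply: eq_card => t'; rewrite [RHS]inE; apply/imsetP/andP => [[g]|[t'Y ut']].
  rewrite inE => /andP[gG tY] ->; split; first exact: tY.
  by apply: (transversal_seq_uniq R_equiv); rewrite map_act_transversal.
have [g gG e] := sharp_trans trt (sub_transversal_seq R_equiv trY ut' (allP t'Y)).
by exists g; [rewrite inE gG e | apply: val_inj].
Qed.

Lemma astabs_setactE Y g : g \in G -> (g \in stab Y) = (to^* Y g == Y).
Proof.
by move=> gG; rewrite -astab1_set inE gG /= inE sub1set inE.
Qed.

(** The elements on the right are sorted by the block to which they move [S]; each fibre is a right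
    coset of the stabiliser of [S]. *)
Lemma card_orbit_supset Y S :
  #|[set b in orbit to^*%act G S | Y \subset b]| * #|stab S|
  = #|[set g in G | Y \subset (to^* S g)%act]|.
Proof.
rewrite -sum_nat_const -[RHS]sum1_card.
rewrite (partition_big (to^* S)%act [in [set b in orbit to^*%act G S | Y \subset b]]) /=.
  apply: eq_bigr => b; rewrite inE => /andP[/orbitP[a aG <-] Yb].
  rewrite sum1dep_card -astab1_set -(astabIdom _ [set S]).
  rewrite -[LHS](card_rcoset _ a) -(amove_act to^*%act S (subxx G) aG).
  apply: eq_card => g; rewrite !inE.
  by case: (_ =P _) => [->|]; rewrite ?andbF ?Yb ?andbT.
by move=> g; rewrite !inE => /andP[gG ->]; rewrite mem_orbit.
Qed.

(** Inversion reduces this to [card_move_into]: the image of [S] under [g] contains [Y] exactly when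
    [g^-1] moves an enumeration of [Y] into [S]. *)
Lemma card_move_supset Y S : transversal_set Y -> #|Y| = 3 -> transversal_set S ->
  #|[set g in G | Y \subset (to^* S g)%act]| = #|S| ^_ 3.
Proof.
move=> trY cY trS; have [t eY] := card_set_tuple cY.
have ut : uniq t by apply/card_uniqP; rewrite (eq_card eY) cY size_tuple.
have trt : transversal_seq t by apply: (sub_transversal_seq R_equiv trY) => // x; rewrite eY.
rewrite -(card_move_into trt trS) -(card_imset _ invg_inj); apply: eq_card => g.
rewrite -[g in LHS]invgK (mem_imset _ _ invg_inj) !inE groupV.
case gG: (g \in G) => //=; rewrite setactVin //.
apply/subsetP/allP => [YS x /mapP[y yt ->]|h x]; last first.
  by rewrite -eY => xt; rewrite inE; apply: h; apply/mapP; exists x.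
by move: yt; rewrite eY => /YS; rewrite inE.
Qed.

(** The two counts above give the number of blocks through a transversal triple, whatever the
    triple. The parameter is characterised by a product, to avoid truncated division. *)
Lemma orbit_divisible_design s S : 0 < s -> (forall x, #|[set y | R x y]| = s) ->
  transversal_set S -> 2 < #|S| < #|X| ->
  exists2 lam, lam * #|stab S| = #|S| ^_ 3
    & divisible_design R 3 s #|S| lam (orbit to^*%act G S).
Proof.
move=> s0 cls trS /andP[S3 SX].
have count Y : transversal_set Y -> #|Y| = 3 ->
    #|[set b in orbit to^*%act G S | Y \subset b]| * #|stab S| = #|S| ^_ 3.
  by move=> trY cY; rewrite card_orbit_supset card_move_supset.
have [t ut tS] := sub_tuple S3.
have trt := sub_transversal_seq R_equiv trS ut tS.
have cY : #|[set x in t]| = 3 by rewrite cardsE (card_uniqP ut) size_tuple.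
have YS : [set x in t] \subset S by apply/subsetP => x; rewrite inE => /tS.
have trY := transversal_setS R_equiv YS trS.
exists #|[set b in orbit to^*%act G S | [set x in t] \subset b]|; first exact: count.
split=> // [|b /orbitP[g gG <-]|Y trY' cY'].
- split=> //; have := count _ trY cY; case: posnP => // ->.
  by move/esym/eqP; rewrite mul0n -leqn0 leqNgt ffact_gt0 S3.
- rewrite card_setact; split=> //; apply/(transversal_setP R_equiv) => x y.
  move=> /imsetP[x' x'S ->] /imsetP[y' y'S ->]; rewrite R_act // => xy.
  by congr (to _ g); move/(transversal_setP R_equiv): trS; apply.
have N0 : 0 < #|stab S| by apply: cardG_gt0.
by apply/eqP; rewrite -(eqn_pmul2r N0) !count.
Qed.

(* The incidence axiom of circle geometries: three points of a circle
   determine it. *)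
Definition circle L : Prop :=
  transversal_set L /\
  forall t g, uniq t -> {subset t <= L} -> g \in G ->
    {subset map (to^~ g) t <= L} -> (to^* L g)%act = L.

(** An element that stabilises [S] keeps three points of [L] inside [L], hence stabilises [L]. *)
Lemma circle_astabs_sub L S : circle L -> S \subset L -> 2 < #|S| ->
  stab S \subset stab L.
Proof.
move=> [trL cL] SL S3; apply/subsetP => g gS.
have gG : g \in G by apply: astabs_dom gS.
have [t ut tS] := sub_tuple S3.
rewrite astabs_setactE // (cL t) // => x; first by move/tS/(subsetP SL).
by case/mapP => y /tS yS ->; apply: (subsetP SL); rewrite astabs_act.
Qed.

Lemma circle_astabsD L T : circle L -> T \subset L -> 2 < #|L :\: T| ->
  stab (L :\: T) = stab L :&: stab T.
Proof.
move=> cL TL c3; apply/eqP; rewrite eqEsubset astabsD andbT subsetI.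
have NL := circle_astabs_sub cL (subsetDl L T) c3; rewrite NL /=.
have -> : stab T = stab (L :\: (L :\: T)) by rewrite setDDr setDv set0U (setIidPr TL).
by apply: subset_trans (astabsD _ _ _); rewrite subsetI NL subxx.
Qed.

(** By the circle axiom, stabilising [L] amounts to moving one fixed triple of [L] into [L]. *)
Lemma card_circle_astabs L : circle L -> 2 < #|L| -> #|stab L| = #|L| ^_ 3.
Proof.
move=> [trL cL] L3; have [t ut tL] := sub_tuple L3.
rewrite -(card_move_into (sub_transversal_seq R_equiv trL ut tL) trL).
apply: eq_card => g; rewrite [RHS]inE; case gG: (g \in G); last first.
  by apply: contraFF gG => /astabs_dom.
rewrite astabs_setactE //; apply/eqP/allP => [e x /mapP[y /tL yL ->] | h].
  by have := mem_setact to g yL; rewrite e.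
exact: (cL t).
Qed.

(** Pads [T] to a triple of distinct points of [L], so that sharp 3-transitivity can be applied to
    sets with fewer than three points. *)
Lemma enum_prefix L T : T \subset L -> #|T| <= 3 <= #|L| ->
  exists t, [/\ uniq t, {subset t <= L} & T = [set x in take #|T| t]].
Proof.
move=> TL /andP[T3 L3]; pose e := enum T ++ enum (L :\: T).
have sz : size (take 3 e) == 3.
  rewrite size_take_min size_cat -!cardE cardsD (setIidPr TL) subnKC ?subset_leq_card //.
  by rewrite (minn_idPl L3).
exists (Tuple sz); split=> /=.
- rewrite take_uniq // cat_uniq !enum_uniq andbT /=.
  by apply/hasPn => x; rewrite !mem_enum inE => /andP[].
- move=> x /mem_take; rewrite mem_cat !mem_enum inE => /orP[/(subsetP TL)|/andP[]] //.
- rewrite take_takel // cardE take_size_cat //.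
  by apply/setP => x; rewrite inE mem_enum.
Qed.

(* Orbit-stabiliser: the group of a circle is transitive on its subsets of size
   at most 3. *)
Lemma card_circle_astabsI L T : circle L -> T \subset L -> #|T| <= 3 <= #|L| ->
  #|stab L :&: stab T| * 'C(#|L|, #|T|) = #|L| ^_ 3.
Proof.
move=> cL TL T3L; have /andP[T3 L3] := T3L; have [trL cirL] := cL.
have sNG : stab L \subset G by apply: subsetIl.
rewrite -card_circle_astabs // -(card_orbit_in_stab to^*%act T sNG) mulnC astab1_set.
congr (_ * _); rewrite -cards_draws; apply: eq_card => S; rewrite [LHS]inE.
have [t [ut tL eT]] := enum_prefix TL T3L.
apply/andP/orbitP => [[SL /eqP cS] | [g gL <-]]; last first.
  rewrite card_setact; split=> //; apply/subsetP => x /imsetP[y yT ->].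
  by rewrite astabs_act // (subsetP TL).
have [t' [ut' t'L eS]] : exists t, [/\ uniq t, {subset t <= L} & S = [set x in take #|S| t]].
  by apply: enum_prefix => //; rewrite cS.
(* The element moving one padded triple to the other stabilises [L] by the circle axiom, and it
   carries the prefix [T] to the prefix [S]. *)
have [g gG e] := sharp_trans (sub_transversal_seq R_equiv trL ut tL)
  (sub_transversal_seq R_equiv trL ut' t'L).
exists g.
  by rewrite astabs_setactE // (cirL t) // e.
rewrite /= {1}eT eS cS -e -map_take; apply/setP => x; rewrite inE.
apply/imsetP/mapP => -[y yt ->]; exists y; rewrite ?inE // in yt *.
Qed.

(** A point [x] is related to at most one of the three points of [o], so the other two complete [x]
    to a transversal triple. *)
Lemma sharp_atrans : [transitive G, on [set: X] | to].
Proof.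
have three : exists2 x1, x1 \in setT & forall x, exists2 g, g \in G & to x1 g = x.
  exists (tnth o ord0) => // x.
  have tr y z : ~~ R y z -> ~~ R x y -> ~~ R x z ->
      exists2 g, g \in G & to (tnth o ord0) g = x.
    move=> yz xy xz; have [] := @G_trans [tuple x; y; z].
      by rewrite /transversal_seq /= xy xz yz.
    move=> g gG e; exists g => //.
    by rewrite (tnth_nth x) -(nth_map x x (to^~ g)) ?size_tuple // e.
  case: o o_transversal tr => [[|a [|b [|c []]]] // sz] /=.
  rewrite !andbT => /andP[/andP[ab ac] bc] tr.
  have sym := equiv_sym R_equiv.
  case xa: (R x a); first apply: (tr b c bc).
  - by rewrite (equiv_transl R_equiv xa).
  - by rewrite (equiv_transl R_equiv xa).
  case xb: (R x b); first apply: (tr a c ac); rewrite ?xa //.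
    by rewrite (equiv_transl R_equiv xb).
  by apply: (tr a b ab); rewrite ?xa ?xb.
case: three => x1 _ h; apply/imsetP; exists x1 => //.
by apply/esym/setP => x; rewrite inE; apply/orbitP; have [g gG <-] := h x; exists g.
Qed.

Lemma sharp_faithful : [faithful G, on [set: X] | to].
Proof.
apply/subsetP => g /setIP[gG gC]; rewrite inE; apply/eqP/G_free => //.
by rewrite -[RHS]map_id; apply: eq_map => x; rewrite (astab_act gC).
Qed.

End SharplyTransitive.

(** * The projective line over the dual numbers *)

Import Order.TTheory GRing.Theory Num.Theory.
Local Open Scope ring_scope.

(** The vanishing determinant forces the second pair to have a unit in the position where the first
    has one; the quotient of these two units is the factor. *)
Lemma proportional (R : comUnitRingType) (a b c d : R) :
  (a \is a GRing.unit) || (b \is a GRing.unit) ->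
  (c \is a GRing.unit) || (d \is a GRing.unit) ->
  a * d = c * b -> exists r, [/\ r \is a GRing.unit, c = r * a & d = r * b].
Proof.
move=> ab cd e; have [ua | nua] := boolP (a \is a GRing.unit).
  have uc : c \is a GRing.unit.
    case/orP: cd => // ud; suff: c * b \is a GRing.unit by rewrite unitrM => /andP[].
    by rewrite -e unitrM ua ud.
  exists (c / a); rewrite unitrM uc unitrV ua divrK //; split=> //.
  by rewrite mulrAC -e mulrAC divrr // mul1r.
rewrite (negbTE nua) /= in ab.
have ud : d \is a GRing.unit.
  case/orP: cd => // uc; suff: a * d \is a GRing.unit by rewrite unitrM => /andP[].
  by rewrite e unitrM ab uc.
exists (d / b); rewrite unitrM ud unitrV ab divrK //; split=> //.
by rewrite mulrAC [d * a]mulrC e -mulrA divrr // mulr1.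
Qed.

Section HomogeneousCoordinates.
Variable F : finFieldType.
Local Notation D := (dual_ring F).
Implicit Types a b r : D.

Definition hvec a b : 'rV[D]_2 := \row_(j < 2) if j == 0 then a else b.

Lemma hvec0 a b : hvec a b 0 0 = a. Proof. by rewrite mxE. Qed.
Lemma hvec1 a b : hvec a b 0 1 = b. Proof. by rewrite mxE. Qed.
Definition hvecE := (hvec0, hvec1).

Lemma rV2P (x y : 'rV[D]_2) : x 0 0 = y 0 0 -> x 0 1 = y 0 1 -> x = y.
Proof.
move=> e0 e1; apply/rowP => j.
have [-> //|j0] := eqVneq j 0.
suff -> : j = 1 by [].
by apply: val_inj; case: j j0 => [[|[]]].
Qed.

Lemma scale_hvec r a b : r *: hvec a b = hvec (r * a) (r * b).
Proof. by apply: rV2P; rewrite mxE !hvecE. Qed.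

Lemma hvecK (x : 'rV[D]_2) : hvec (x 0 0) (x 0 1) = x.
Proof. by apply: rV2P; rewrite hvecE. Qed.

Definition admissible_pair a b : bool :=
  (a \is a GRing.unit) || (b \is a GRing.unit).

Lemma admissible_hvec a b : admissible (hvec a b) = admissible_pair a b.
Proof. by rewrite /admissible !hvecE. Qed.

Lemma admissible_pair1l b : admissible_pair 1 b.
Proof. by rewrite /admissible_pair unitr1. Qed.

Lemma admissible_pair1r a : admissible_pair a 1.
Proof. by rewrite /admissible_pair unitr1 orbT. Qed.

Lemma admissible_infty : admissible (hvec 1 0).
Proof. by rewrite admissible_hvec admissible_pair1l. Qed.

End HomogeneousCoordinates.

(* [hpoint a b] is the point with homogeneous coordinates (a, b); on pairs that
   are not admissible it has the junk value (1 : 0). It is locked because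
   comparing points by unfolding does not terminate in practice. *)
HB.lock Definition hpoint (F : finFieldType) (a b : dual_ring F) : point F :=
  insubd (mkpoint (admissible_infty F)) (unit_class (hvec a b)).

(** * The projective group and parallelism in homogeneous coordinates *)

Section ProjectiveGroupAction.
Variable F : finFieldType.
Local Notation D := (dual_ring F).
Local Notation G := (projective_group F).
Local Notation to := (projective_action F).
Implicit Types (a b c d e f r : D) (P Q : point F) (M : {'GL_2[D]}).

Lemma hpointE a b (h : admissible (hvec a b)) : hpoint a b = mkpoint h.
Proof. by rewrite unlock; apply: val_inj; rewrite val_insubd (unit_class_is_point h). Qed.

Lemma hpointP P : exists a b, admissible_pair a b /\ P = hpoint a b.
Proof.
have [x [hx ->]] := pointP P.
exists (x 0 0), (x 0 1); split=> //.
rewrite hpointE ?admissible_hvec // => h.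
by apply: val_inj; rewrite /= hvecK.
Qed.

Lemma parallel_hpoint a b c d : admissible_pair a b -> admissible_pair c d ->
  parallel (hpoint a b) (hpoint c d) = (a * d - c * b \isn't a GRing.unit).
Proof.
rewrite -!admissible_hvec => h h'.
by rewrite (hpointE h) (hpointE h') parallelE !hvecE.
Qed.

Lemma hpointZ r a b : r \is a GRing.unit -> hpoint (r * a) (r * b) = hpoint a b.
Proof.
move=> ur; rewrite unlock; suff -> : unit_class (hvec (r * a) (r * b)) = unit_class (hvec a b) by [].
apply/setP => y; rewrite -scale_hvec.
apply/imsetP/imsetP => -[s]; rewrite inE => us ->.
  by exists (s * r); [rewrite inE unitrM us ur | rewrite scalerA].
by exists (s / r); [rewrite inE unitrM us unitrV ur | rewrite scalerA divrK].
Qed.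

Lemma hpoint_eqP a b c d : admissible_pair a b -> admissible_pair c d ->
  reflect (hpoint a b = hpoint c d) (a * d == c * b).
Proof.
move=> h h'; apply: (iffP eqP) => [e|].
  by have [r [ur -> ->]] := proportional h h' e; rewrite hpointZ.
rewrite -!admissible_hvec in h h' *.
rewrite (hpointE h) (hpointE h') => /(congr1 val) /= e.
have : hvec a b \in unit_class (hvec a b).
  by apply/imsetP; exists 1; [rewrite inE unitr1 | rewrite scale1r].
rewrite e => {e} /imsetP[r _]; rewrite scale_hvec => e.
have := congr1 (fun x : 'rV_2 => x 0 0) e; have := congr1 (fun x : 'rV_2 => x 0 1) e.
by rewrite !hvecE => -> ->; rewrite [r * c]mulrC mulrA.
Qed.

Lemma hpoint_inj1 : injective (fun a => hpoint a 1).
Proof.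
move=> a b /(hpoint_eqP (admissible_pair1r _) (admissible_pair1r _)).
by rewrite !mulr1 => /eqP.
Qed.

Lemma mulmx_rV2 (x : 'rV[D]_2) (N : 'M[D]_2) j :
  (x *m N) 0 j = x 0 0 * N 0 j + x 0 1 * N 1 j.
Proof.
rewrite mxE big_ord_recl big_ord1.
by rewrite (_ : lift ord0 ord0 = 1) //; apply: val_inj.
Qed.

Lemma projective_act_hpoint a b M : admissible_pair a b ->
  to (hpoint a b) (coset (scalars F) M) =
  hpoint (a * GLval M 0 0 + b * GLval M 1 0) (a * GLval M 0 1 + b * GLval M 1 1).
Proof.
rewrite -admissible_hvec => h; rewrite (hpointE h) projective_actE.
rewrite hpointE => [|h']; last first.
  by apply: val_inj; congr (unit_class _); apply: rV2P; rewrite mulmx_rV2 !hvecE.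
rewrite (_ : hvec _ _ = hvec a b *m GLval M) ?admissible_mulmx //.
by apply: rV2P; rewrite mulmx_rV2 !hvecE.
Qed.

Lemma admissible_pair_mul a b M : admissible_pair a b ->
  admissible_pair (a * GLval M 0 0 + b * GLval M 1 0)
                  (a * GLval M 0 1 + b * GLval M 1 1).
Proof.
rewrite -admissible_hvec => /(admissible_mulmx M).
by rewrite /admissible !mulmx_rV2 !hvecE.
Qed.

Lemma projective_groupP g : g \in G -> exists M, g = coset (scalars F) M.
Proof. by move=> _; have [M _ ->] := cosetP g; exists M. Qed.

Lemma mem_projective_group M : coset (scalars F) M \in G.
Proof. by rewrite mem_quotient // inE. Qed.

Lemma det_mx2 (N : 'M[D]_2) : \det N = N 0 0 * N 1 1 - N 1 0 * N 0 1.
Proof.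
rewrite (expand_det_row _ 0) big_ord_recl big_ord1 /cofactor !det_mx11 !mxE /=.
have -> : lift ord0 ord0 = 1 :> 'I_2 by apply: val_inj.
have -> : lift (1 : 'I_2) 0 = 0 by apply: val_inj.
by rewrite expr0 expr1; ring.
Qed.

Definition mx2 a b c d : 'M[D]_2 :=
  \matrix_(i < 2, j < 2) if i == 0 then hvec a b 0 j else hvec c d 0 j.

Lemma mx2_unit a b c d : a * d - c * b \is a GRing.unit ->
  mx2 a b c d \is a GRing.unit.
Proof.
by move=> u; rewrite -[_ \is a _]/(mx2 a b c d \in unitmx) unitmxE det_mx2 !mxE.
Qed.

Definition gl2 a b c d (u : a * d - c * b \is a GRing.unit) : {'GL_2[D]} :=
  FinRing.Unit (mx2_unit u).

Lemma act_gl2 a b c d (u : a * d - c * b \is a GRing.unit) e f :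
  admissible_pair e f ->
  to (hpoint e f) (coset (scalars F) (gl2 u)) = hpoint (e * a + f * c) (e * b + f * d).
Proof. by move=> h; rewrite (projective_act_hpoint _ h) !mxE. Qed.

Lemma GL2_unit M :
  GLval M 0 0 * GLval M 1 1 - GLval M 1 0 * GLval M 0 1 \is a GRing.unit.
Proof. by have := GL_unitmx M; rewrite unitmxE (det_mx2 (GLval M)). Qed.

(** The action multiplies the determinant of two coordinate vectors by the determinant of the
    matrix, which is a unit. *)
Lemma parallel_act g : g \in G ->
  forall P Q, parallel (to P g) (to Q g) = parallel P Q.
Proof.
case/projective_groupP => M -> P Q.
have [a [b [h ->]]] := hpointP P; have [c [d [h' ->]]] := hpointP Q.
rewrite (projective_act_hpoint _ h) (projective_act_hpoint _ h').
rewrite (parallel_hpoint (admissible_pair_mul _ h) (admissible_pair_mul _ h')).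
rewrite (parallel_hpoint h h') -[in RHS](unitrMr _ (GL2_unit M)).
by congr (_ \isn't a GRing.unit); ring.
Qed.

(** A dual number is a non-unit exactly when its real part vanishes, so two points are parallel when
    their reductions to the projective line over [F] coincide. There, [key] turns a zero determinant
    into a nonzero factor. *)
Lemma parallel_equiv : equivalence_rel (@parallel F).
Proof.
move=> P Q S; have [a [b [h ->]]] := hpointP P.
have [c [d [h' ->]]] := hpointP Q; have [e [f [h2 ->]]] := hpointP S.
rewrite !parallel_hpoint // subrr unitr0; split=> //.
rewrite !dual_unitE !raddfB /= !negbK !subr_eq0.
move: h h' h2; rewrite /admissible_pair !dual_unitE.
move: (dre a) (dre b) (dre c) (dre d) (dre e) (dre f) => {}a {}b {}c {}d {}e {}f.
move=> h h' h2 /eqP adcb.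
have key (x y z t : F) : (x != 0) || (y != 0) -> (z != 0) || (t != 0) ->
    x * t = z * y -> exists2 r, r != 0 & z = r * x /\ t = r * y.
  move=> + zt; case: (eqVneq x 0) => [->|x0] /=.
    rewrite mul0r => y0 /esym/eqP; rewrite mulf_eq0 (negbTE y0) orbF => /eqP z0.
    move: zt; rewrite z0 eqxx /= => t0.
    by exists (t / y); rewrite ?mulf_neq0 ?invr_neq0 // mulr0 divfK.
  move=> _ e1; have z0 : z != 0.
    apply: contraTneq zt => z0; rewrite z0 eqxx /= negbK.
    by move/eqP: e1; rewrite z0 mul0r mulf_eq0 (negbTE x0).
  exists (z / x); rewrite ?mulf_neq0 ?invr_neq0 // divfK //; split=> //.
  by rewrite mulrAC -e1 mulrAC divff // mul1r.
have [r r0 [-> ->]] := key _ _ _ _ h h' adcb.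
by rewrite -[r * a * f]mulrA [e * (r * b)]mulrCA (inj_eq (mulfI r0)).
Qed.

End ProjectiveGroupAction.

(** * Sharp 3-transitivity, parallel classes and the number of points *)

Section SharpTransitivity.
Variable F : finFieldType.
Local Notation D := (dual_ring F).
Local Notation G := (projective_group F).
Local Notation to := (projective_action F).
Local Notation coset_gl2 u := (coset (scalars F) (gl2 u)).
Implicit Types (a b c d e f r : D) (P Q : point F) (M : {'GL_2[D]}).

Definition base_frame : 3.-tuple (point F) :=
  [tuple @hpoint F 1 0; @hpoint F 0 1; @hpoint F 1 1].

Lemma base_frame_transversal : transversal_seq (@parallel F) base_frame.
Proof.
rewrite /transversal_seq /= !parallel_hpoint ?admissible_pair1l ?admissible_pair1r //.
by rewrite !mulr1 !mul0r !mul1r subr0 sub0r unitrN !unitr1.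
Qed.

Lemma map_base_frame a b c d (u : a * d - c * b \is a GRing.unit) :
  map (to^~ (coset_gl2 u)) base_frame =
  [:: @hpoint F a b; @hpoint F c d; @hpoint F (a + c) (b + d)].
Proof.
rewrite /= !(act_gl2 u) ?admissible_pair1l ?admissible_pair1r //.
by rewrite !mul1r !mul0r !add0r !addr0.
Qed.

(* The frame of the points x, y, z is obtained by scaling the coordinate
   vectors of x and y so that they add up to that of z (Cramer's rule). *)
Lemma frame_matrix a b c d e f
  (al := (e * d - c * f) / (a * d - c * b))
  (be := (a * f - e * b) / (a * d - c * b)) :
  a * d - c * b \is a GRing.unit -> a * f - e * b \is a GRing.unit ->
  c * f - e * d \is a GRing.unit ->
  exists u : al * a * (be * d) - be * c * (al * b) \is a GRing.unit,
    map (to^~ (coset_gl2 u)) base_frame =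
      [:: @hpoint F a b; @hpoint F c d; @hpoint F e f].
Proof.
move=> u1 u3 u2.
have ual : al \is a GRing.unit.
  by rewrite /al unitrM unitrV u1 andbT -opprB unitrN.
have ube : be \is a GRing.unit by rewrite /be unitrM unitrV u1 u3.
have eal : al * (a * d - c * b) = e * d - c * f by rewrite divrK.
have ebe : be * (a * d - c * b) = a * f - e * b by rewrite divrK.
(* The coefficients are kept only as units satisfying [eal] and [ebe], so that the remaining
   identities involve no division. *)
clearbody al be.
have u : al * a * (be * d) - be * c * (al * b) \is a GRing.unit.
  have -> : al * a * (be * d) - be * c * (al * b) = al * be * (a * d - c * b) by ring.
  by rewrite !unitrM ual ube u1.
exists u; rewrite map_base_frame (hpointZ a b ual) (hpointZ c d ube).
have -> : al * a + be * c = e.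
  by apply: (mulIr u1); rewrite mulrDl mulrAC [_ * c * _]mulrAC eal ebe; ring.
have -> : al * b + be * d = f.
  by apply: (mulIr u1); rewrite mulrDl mulrAC [_ * d * _]mulrAC eal ebe; ring.
by [].
Qed.

Lemma base_frame_trans (t : 3.-tuple (point F)) :
  transversal_seq (@parallel F) t ->
  exists2 g, g \in G & map (to^~ g) base_frame = t.
Proof.
case: t => [[|x [|y [|z []]]] // sz]; rewrite /transversal_seq /=.
have [a [b [h ->]]] := hpointP x; have [c [d [h' ->]]] := hpointP y.
have [e [f [h2 ->]]] := hpointP z.
rewrite (parallel_hpoint h h') (parallel_hpoint h h2) (parallel_hpoint h' h2).
rewrite !negbK !andbT => /andP[/andP[u1 u2] u3].
have [u eu] := frame_matrix u1 u2 u3.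
by exists (coset_gl2 u); [apply: mem_projective_group | apply: eu].
Qed.

(** A matrix fixing (1 : 0) and (0 : 1) is diagonal; if it also fixes (1 : 1), its diagonal entries
    agree and it is scalar. *)
Lemma base_frame_free g : g \in G -> map (to^~ g) base_frame = base_frame -> g = 1%g.
Proof.
case/projective_groupP => M -> /= [].
have adm := admissible_pair_mul M.
have [h1 h2 h3] : [/\ admissible_pair (1 : D) 0, admissible_pair (0 : D) 1
  & admissible_pair (1 : D) 1].
  by rewrite !(admissible_pair1l, admissible_pair1r).
move=> /(etrans (esym (projective_act_hpoint M h1)))/(hpoint_eqP (adm _ _ h1) h1).
move=> e1 /(etrans (esym (projective_act_hpoint M h2)))/(hpoint_eqP (adm _ _ h2) h2).
move=> e2 /(etrans (esym (projective_act_hpoint M h3)))/(hpoint_eqP (adm _ _ h3) h3).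
move: e1 e2; rewrite !(mul1r, mul0r, mulr1, mulr0, add0r, addr0) => /eqP e1 /eqP e2.
rewrite e2 -e1 add0r addr0 => /eqP e3.
apply: coset_id; rewrite inE; apply/existsP; exists (GLval M 0 0).
have := GL2_unit M; rewrite e2 -e1 mul0r subr0 unitrM => /andP[-> _] /=.
apply/eqP/matrixP => i j; rewrite mxE.
have ord2 (k : 'I_2) : {k = 0} + {k = 1}.
  by case: k => [[|[|//]]] lt; [left | right]; apply: val_inj.
by case: (ord2 i) => ->; case: (ord2 j) => ->; rewrite /= ?mulr1n ?mulr0n.
Qed.

Lemma projective_group_trans :
  [transitive G, on [set: point F] | projective_action F].
Proof.
exact: (sharp_atrans (@parallel_equiv F) base_frame_transversal base_frame_trans).
Qed.

Lemma projective_group_faithful :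
  [faithful G, on [set: point F] | projective_action F].
Proof. exact: (sharp_faithful base_frame_free). Qed.

Lemma hpoint_unit a b : b \is a GRing.unit -> @hpoint F a b = @hpoint F (a / b) 1.
Proof.
by move=> ub; rewrite -(hpointZ (a / b) 1 ub) mulr1 mulrC divrK.
Qed.

Definition dual_eps (y : F) : D := Dual 0 y.

(** If [d] is a non-unit in an admissible pair (c : d), then [c] is a unit, and dividing by it
    leaves a multiple of epsilon in second place. *)
Lemma parallel_infty :
  [set Q | parallel (@hpoint F 1 0) Q] = [set @hpoint F 1 (dual_eps y) | y : F].
Proof.
apply/setP => Q; rewrite inE; apply/idP/imsetP => [|[y _ ->]]; last first.
  rewrite parallel_hpoint ?admissible_pair1l // mul1r mulr0 subr0.
  by rewrite dual_unitE eqxx.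
have [c [d [h ->]]] := hpointP Q.
rewrite (parallel_hpoint (admissible_pair1l _) h) mul1r mulr0 subr0 => nd.
have uc : c \is a GRing.unit by move: h; rewrite /admissible_pair (negbTE nd) orbF.
have : d / c \isn't a GRing.unit by rewrite unitrM (negbTE nd).
rewrite dual_unitE negbK => /eqP e; exists (deps (d / c)); first by [].
have -> : dual_eps (deps (d / c)) = d / c.
  by rewrite /dual_eps -[in LHS]e; case: (d / c).
by rewrite -[in RHS](hpointZ _ _ uc) mulr1 mulrC divrK.
Qed.

Lemma dual_eps_inj : injective dual_eps.
Proof. by move=> x y []. Qed.

Lemma card_parallel_class P : #|[set Q | parallel P Q]| = #|F|.
Proof.
have /imsetP[P0 _ orb] := projective_group_trans.
have eqc (Q : point F) : #|[set Q' | parallel Q Q']| = #|[set Q' | parallel P0 Q']|.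
  have : Q \in orbit to G P0 by rewrite -orb inE.
  case/orbitP => g gG <-; rewrite -(card_preimset _ (act_inj to g)).
  by apply: eq_card => Q'; rewrite !inE parallel_act.
rewrite (eqc P) -(eqc (@hpoint F 1 0)) parallel_infty card_imset // => x y.
move/(hpoint_eqP (admissible_pair1l _) (admissible_pair1l _)).
by rewrite !mul1r => /eqP/dual_eps_inj.
Qed.

Lemma card_dual : #|D| = (#|F| * #|F|)%N.
Proof.
rewrite -card_prod; apply: (bij_eq_card (f := @pair_of_dual F)).
by exists (@dual_of_pair F) => [|[]] //; apply: pair_of_dualK.
Qed.

Lemma hpoint_neq_infty a : (@hpoint F a 1 == @hpoint F 1 0) = false.
Proof.
apply/negP => /eqP /(hpoint_eqP (admissible_pair1r _) (admissible_pair1l _)).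
by rewrite mulr0 mulr1 eq_sym oner_eq0.
Qed.

(** The points (a : 1) are as many as the elements of the ring; all others have a non-unit second
    coordinate and form the parallel class of (1 : 0). *)
Lemma card_point : #|point F| = (#|F| * (#|F| + 1))%N.
Proof.
pose A := [set @hpoint F a 1 | a : D].
rewrite -cardsT -(cardsID A) setTI setTD mulnDr muln1; congr (_ + _)%N.
  by rewrite card_imset ?card_dual //; apply: hpoint_inj1.
rewrite -(card_parallel_class (@hpoint F 1 0)); apply: eq_card => P.
rewrite !inE; have [a [b [h ->]]] := hpointP P.
rewrite (parallel_hpoint (admissible_pair1l _) h) mul1r mulr0 subr0.
congr (~~ _); apply/imsetP/idP => [[c _]|ub]; last by exists (a / b) => //; apply: hpoint_unit.
move/(hpoint_eqP h (admissible_pair1r _)); rewrite mulr1 => /eqP e.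
by move: h; rewrite /admissible_pair e unitrM; case: (b \is a GRing.unit); rewrite ?andbF.
Qed.

End SharpTransitivity.

(** * Sublines and four-sets *)

Section BlockDesign.
Variable F : finFieldType.
Local Notation G := (projective_group F).
Local Notation to := (projective_action F).
Implicit Types S : {set point F}.

(** The points (1 : 0) and (1 : epsilon) are distinct and parallel, so a transversal set omits some
    point. *)
Lemma transversal_card_lt S : transversal_set (@parallel F) S -> (#|S| < #|point F|)%N.
Proof.
move=> /(transversal_setP (@parallel_equiv F)) trS.
rewrite -cardsT proper_card // properT; apply/negP => /eqP eS.
pose P y : point F := hpoint 1 (dual_eps y).
have : P 1 = P 0.
  apply: trS; rewrite ?eS ?inE // parallel_hpoint ?admissible_pair1l //.
  by rewrite !mul1r dual_unitE raddfB subrr eqxx.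
move/(hpoint_eqP (admissible_pair1l _) (admissible_pair1l _)).
by rewrite !mul1r => /eqP/dual_eps_inj/esym/eqP; rewrite oner_eq0.
Qed.

(** Reduces every row of the list to the order of a stabiliser: the blocks form the orbit of [S]. *)
Lemma block_design S : transversal_set (@parallel F) S -> (2 < #|S|)%N ->
  exists_projective_design F #|S| ((#|S| ^_ 3)%N%:R / #|'N(S | to)%g|%:R).
Proof.
move=> trS S3; set k := #|S|; set N := #|_|; set q := #|F|.
have q1 : (1 < q)%N by apply: finNzRing_gt1.
have N0 : N%:R != 0 :> rat by rewrite pnatr_eq0 -lt0n cardG_gt0.
have [|lam elam dd3] := orbit_divisible_design (@parallel_equiv F) (@parallel_act F)
  (@base_frame_trans F) (@base_frame_free F) (ltnW q1) (@card_parallel_class F) trS.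
  by rewrite S3 transversal_card_lt.
have cq : (#|point F| - 2 * q = q * (q - 1))%N.
  by rewrite card_point -/q mulnDr mulnBr; lia.
have [|lam2 elam2 dd2] := divisible_design2 (@parallel_equiv F) dd3 (orbit_refl to^*%act G S).
  by rewrite card_point -/q mulnC ltn_pmul2l ?(ltnW q1) // addn1.
have rlam : lam%:R = (k ^_ 3)%N%:R / N%:R :> rat.
  by rewrite -elam natrM mulfK.
exists (orbit to^*%act G S).
- split; first by exists lam.
  exists lam2 => //; rewrite -rlam.
  have k2 : (k - 2)%N%:R != 0 :> rat by rewrite pnatr_eq0 -lt0n subn_gt0.
  have -> : k%:R - 2 = (k - 2)%N%:R :> rat by rewrite natrB // ltnW.
  have -> : #|F|%:R - 1 = (q - 1)%N%:R :> rat by rewrite natrB // ltnW.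
  apply: (mulIf k2); rewrite divfK // -!natrM; congr _%:R.
  by rewrite elam2 cq.
- split; [split=> //; first exact: projective_group_faithful | |].
  + move=> g gG; split=> [x y | b]; first by rewrite !actpermE parallel_act.
    case/orbitP => h hG <-; have -> : actperm to g @: to^*%act S h = to^*%act S (h * g)%g.
      by rewrite actMin //; apply: eq_imset => x; rewrite actpermE.
    by rewrite mem_orbit // groupM.
  + exact: projective_group_trans.
  + exact: atrans_orbit.
Qed.

End BlockDesign.

(** * The projective line over a subfield [K] of the dual numbers is a circle *)

Section Subline.
Variable F : finFieldType.
Local Notation D := (dual_ring F).
Local Notation G := (projective_group F).
Local Notation to := (projective_action F).
Variable K : {set D}.
Hypothesis K1 : 1 \in K.
Hypothesis KB : {in K &, forall a b, a - b \in K}.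
Hypothesis KM : {in K &, forall a b, a * b \in K}.
Hypothesis KV : {in K, forall a, a^-1 \in K}.
Hypothesis KU : {in K, forall a, a != 0 -> a \is a GRing.unit}.

Lemma subfield0 : 0 \in K.
Proof. by have := KB K1 K1; rewrite subrr. Qed.

Lemma subfieldD : {in K &, forall a b, a + b \in K}.
Proof.
move=> a b aK bK; have -> : a + b = a - (0 - b) by rewrite sub0r opprK.
by apply: KB => //; apply: KB => //; apply: subfield0.
Qed.

Definition subline : {set point F} := @hpoint F 1 0 |: [set @hpoint F a 1 | a in K].

Lemma sublineP P :
  reflect (exists a b, [/\ a \in K, b \in K, admissible_pair a b & P = hpoint a b])
          (P \in subline).
Proof.
apply: (iffP setU1P) => [[->|/imsetP[a aK ->]]|[a [b [aK bK h ->]]]].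
- by exists 1, 0; rewrite K1 subfield0 admissible_pair1l.
- by exists a, 1; rewrite aK K1 admissible_pair1r.
have [b0|b0] := eqVneq b 0.
  left; move: h; rewrite b0 /admissible_pair unitr0 orbF => ua.
  by rewrite -[RHS](hpointZ 1 0 ua) mulr1 mulr0.
right; apply/imsetP; exists (a / b); first by rewrite KM ?KV.
by apply: hpoint_unit; apply: KU.
Qed.

Lemma card_subline : #|subline| = (#|K| + 1)%N.
Proof.
have ninf : @hpoint F 1 0 \notin [set @hpoint F a 1 | a in K].
  by apply/negP => /imsetP[a _ /esym/eqP]; rewrite hpoint_neq_infty.
by rewrite cardsU1 ninf (card_imset _ (@hpoint_inj1 F)) addnC.
Qed.

(** The determinant of two points with coordinates in [K] lies in [K], hence is zero or a unit: the
    points are equal or not parallel. *)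
Lemma subline_transversal : transversal_set (@parallel F) subline.
Proof.
apply/(transversal_setP (@parallel_equiv F)) => P Q.
move=> /sublineP[a [b [aK bK h ->]]] /sublineP[c [d [cK dK h' ->]]].
rewrite (parallel_hpoint h h') => nu; apply/(hpoint_eqP h h').
rewrite -subr_eq0; apply: contraR nu => /KU; apply.
by rewrite KB // KM.
Qed.

(** The matrix of [frame_matrix] is built by field operations from the coordinates, so its entries
    lie in [K] and it preserves the subline. *)
Lemma subline_frame (t : 3.-tuple (point F)) : uniq t -> {subset t <= subline} ->
  exists2 g, g \in 'N(subline | to)%g & map (to^~ g) (base_frame F) = t.
Proof.
move=> ut tL.
have := sub_transversal_seq (@parallel_equiv F) subline_transversal ut tL.
case: t ut tL => [[|x [|y [|z []]]] // sz] _ tL; rewrite /transversal_seq /=.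
have /sublineP[a [b [aK bK h ->]]] : x \in subline by apply: tL; rewrite !inE eqxx.
have /sublineP[c [d [cK dK h' ->]]] : y \in subline by apply: tL; rewrite !inE eqxx orbT.
have /sublineP[e [f [eK fK h2 ->]]] : z \in subline by apply: tL; rewrite !inE eqxx !orbT.
rewrite (parallel_hpoint h h') (parallel_hpoint h h2) (parallel_hpoint h' h2).
rewrite !negbK !andbT => /andP[/andP[u1 u2] u3].
have [u eu] := frame_matrix u1 u2 u3.
exists (coset (scalars F) (gl2 u)); last exact: eu.
rewrite (astabs_setactE _ _ (mem_projective_group _)) eqEcard card_setact leqnn andbT.
apply/subsetP => _ /imsetP[_ /sublineP[v [w [vK wK hvw ->]]] ->].
rewrite (act_gl2 u hvw); apply/sublineP.
have adm := admissible_pair_mul (gl2 u) hvw; rewrite !mxE in adm.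
have KD := subfieldD.
have KM2 k1 k2 k3 k4 : k1 \in K -> k2 \in K -> k3 \in K -> k4 \in K ->
  k1 * k2 - k3 * k4 \in K by move=> *; apply: KB; apply: KM.
have KMV k1 k2 : k1 \in K -> k2 \in K -> k1 / k2 \in K.
  by move=> *; apply: KM => //; apply: KV.
eexists; eexists; split; [| |exact: adm|reflexivity];
  by apply: KD; apply: KM => //; apply: KM => //; apply: KMV; apply: KM2.
Qed.

(** Elements [a] and [b] stabilising the subline send the base frame to [t] and to its image under
    [g]; sharpness then gives that [g] is [a^-1 * b]. *)
Lemma subline_circle : circle (@parallel F) to subline.
Proof.
split=> [|t g ut tL gG gtL]; first exact: subline_transversal.
have gut : uniq (map_tuple (to^~ g) t) by rewrite /= map_inj_uniq //; apply: act_inj.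
have [a aL ea] := subline_frame ut tL; have [b bL eb] := subline_frame gut gtL.
have aG := astabs_dom aL; have bG := astabs_dom bL.
have <- : (a^-1 * b)%g = g.
  apply: (sharp_inj (@base_frame_trans F) (@base_frame_free F) (t := t)).
  - exact: (sub_transversal_seq (@parallel_equiv F) subline_transversal).
  - by rewrite groupM ?groupV.
  - by [].
  - by rewrite map_actM ?groupV // -[in LHS]ea map_actK.
by apply/eqP; rewrite -astabs_setactE ?groupM ?groupV.
Qed.

End Subline.

(** * The stabiliser of the four points infinity, 0, 1, c *)

Section Tetrad.
Variable F : finFieldType.
Local Notation D := (dual_ring F).
Local Notation G := (projective_group F).
Local Notation to := (projective_action F).
Local Notation coset_gl2 u := (coset (scalars F) (gl2 u)).
Variable c : D.
Hypothesis c_unit : c \is a GRing.unit.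
Hypothesis c1_unit : c - 1 \is a GRing.unit.
Implicit Types (x y u v : D) (g : coset_of (scalars F)).

Local Notation infty := (@hpoint F 1 0).
Local Notation pt x := (@hpoint F x 1).
Local Notation aff_pts := [:: 0; 1; c].

Definition tetrad : {set point F} := infty |: [set pt x | x in aff_pts].

Lemma mem_tetrad_infty : infty \in tetrad.
Proof. by rewrite !inE eqxx. Qed.

Lemma mem_tetrad x : (pt x \in tetrad) = (x \in aff_pts).
Proof.
by rewrite in_setU1 hpoint_neq_infty (mem_imset _ _ (@hpoint_inj1 F)).
Qed.

Lemma c_neq0 : c != 0.
Proof. by apply: contraTneq c_unit => ->; rewrite unitr0. Qed.

Lemma c_neq1 : c != 1.
Proof. by apply: contraTneq c1_unit => ->; rewrite subrr unitr0. Qed.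

Lemma aff_ptsP x : x \in aff_pts -> [\/ x = 0, x = 1 | x = c].
Proof. by rewrite !inE => /or3P[]/eqP; [constructor 1 | constructor 2 | constructor 3]. Qed.

Lemma aff_pts_uniq : uniq aff_pts.
Proof.
by rewrite /= !inE negb_or eq_sym oner_eq0 eq_sym c_neq0 eq_sym c_neq1.
Qed.

Lemma card_tetrad : #|tetrad| = 4.
Proof.
have ninf : infty \notin [set pt x | x in aff_pts].
  by apply/negP => /imsetP[x _ /esym/eqP]; rewrite hpoint_neq_infty.
rewrite cardsU1 ninf (card_imset _ (@hpoint_inj1 F)).
by rewrite (card_uniqP aff_pts_uniq).
Qed.

Lemma aff_pts_diff x y : x \in aff_pts -> y \in aff_pts -> x != y ->
  y - x \is a GRing.unit.
Proof.
have c1' : 1 - c \is a GRing.unit by rewrite -opprB unitrN.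
rewrite !inE => /or3P[]/eqP-> /or3P[]/eqP->; rewrite ?eqxx // => _;
  by rewrite ?subr0 ?sub0r ?unitrN ?unitr1 ?c_unit ?c1_unit ?c1'.
Qed.

Lemma tetrad_astabs g : g \in G -> (forall P, P \in tetrad -> to P g \in tetrad) ->
  g \in 'N(tetrad | to)%g.
Proof.
move=> gG h; rewrite (astabs_setactE _ _ gG) eqEcard card_setact leqnn andbT.
by apply/subsetP => _ /imsetP[P /h PT ->].
Qed.

Lemma act_gl2_eq x1 x2 x3 x4 (U : x1 * x4 - x3 * x2 \is a GRing.unit) x y u v :
  admissible_pair x y -> admissible_pair u v ->
  (x * x1 + y * x3) * v = u * (x * x2 + y * x4) ->
  to (hpoint x y) (coset_gl2 U) = hpoint u v.
Proof.
move=> h h' e; rewrite (act_gl2 U h); apply/(hpoint_eqP _ h'); last exact/eqP.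
by have := admissible_pair_mul (gl2 U) h; rewrite !mxE.
Qed.

(* The maps z -> c / z, z -> (z - c) / (z - 1) and z -> c (z - 1) / (z - c)
   realise the Klein four-group on the tetrad. *)
Lemma tetrad_trans : orbit to 'N(tetrad | to)%g infty = tetrad.
Proof.
have a1 := @admissible_pair1l F; have a2 := @admissible_pair1r F.
apply/eqP; rewrite eqEsubset; apply/andP; split.
  apply/subsetP => _ /orbitP[g gN <-]; rewrite astabs_act //.
  exact: mem_tetrad_infty.
have U0 : 0 * 0 - c * 1 \is a GRing.unit by rewrite mul0r sub0r mulr1 unitrN.
have U1 : 1 * (-1) - (- c) * 1 \is a GRing.unit.
  by rewrite mul1r mulr1 opprK addrC.
have Uc : c * (- c) - (- c) * 1 \is a GRing.unit.
  have -> : c * (- c) - (- c) * 1 = - (c * (c - 1)) by ring.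
  by rewrite unitrN unitrM c_unit c1_unit.
have img x1 x2 x3 x4 (U : x1 * x4 - x3 * x2 \is a GRing.unit) :
    to infty (coset_gl2 U) \in tetrad ->
    (forall x, x \in aff_pts -> to (pt x) (coset_gl2 U) \in tetrad) ->
    to infty (coset_gl2 U) \in orbit to 'N(tetrad | to)%g infty.
  move=> h h'; rewrite mem_orbit // tetrad_astabs ?mem_projective_group // => P.
  by case/setU1P => [->|/imsetP[x xs ->]] //; apply: h'.
have t0 : pt 0 \in tetrad by rewrite mem_tetrad !inE eqxx.
have t1 : pt 1 \in tetrad by rewrite mem_tetrad !inE eqxx orbT.
have tc : pt c \in tetrad by rewrite mem_tetrad !inE eqxx !orbT.
have ti := mem_tetrad_infty.
apply/subsetP => P /setU1P[->|/imsetP[x /aff_ptsP[]-> ->]]; first exact: orbit_refl.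
- have e : to infty (coset_gl2 U0) = pt 0 by apply: act_gl2_eq => //; ring.
  rewrite -e; apply: img; first by rewrite e.
  move=> y /aff_ptsP[]->.
  + by have -> : to (pt 0) (coset_gl2 U0) = infty by apply: act_gl2_eq => //; ring.
  + by have -> : to (pt 1) (coset_gl2 U0) = pt c by apply: act_gl2_eq => //; ring.
  + by have -> : to (pt c) (coset_gl2 U0) = pt 1 by apply: act_gl2_eq => //; ring.
- have e : to infty (coset_gl2 U1) = pt 1 by apply: act_gl2_eq => //; ring.
  rewrite -e; apply: img; first by rewrite e.
  move=> y /aff_ptsP[]->.
  + by have -> : to (pt 0) (coset_gl2 U1) = pt c by apply: act_gl2_eq => //; ring.
  + by have -> : to (pt 1) (coset_gl2 U1) = infty by apply: act_gl2_eq => //; ring.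
  + by have -> : to (pt c) (coset_gl2 U1) = pt 0 by apply: act_gl2_eq => //; ring.
- have e : to infty (coset_gl2 Uc) = pt c by apply: act_gl2_eq => //; ring.
  rewrite -e; apply: img; first by rewrite e.
  move=> y /aff_ptsP[]->.
  + by have -> : to (pt 0) (coset_gl2 Uc) = pt 1 by apply: act_gl2_eq => //; ring.
  + by have -> : to (pt 1) (coset_gl2 Uc) = pt 0 by apply: act_gl2_eq => //; ring.
  + by have -> : to (pt c) (coset_gl2 Uc) = infty by apply: act_gl2_eq => //; ring.
Qed.

(** A pair (u, v) encodes the affine map sending 0 to [u] and 1 to [v]; the filter asks that the
    image of [c] is again one of 0, 1, c. *)
Definition affine_pairs : seq (D * D) :=
  [seq uv <- [:: (0, 1); (0, c); (1, 0); (1, c); (c, 0); (c, 1)]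
     | uv.1 + (uv.2 - uv.1) * c \in aff_pts].

Lemma mem_affine_pairs u v : ((u, v) \in affine_pairs) =
  [&& u \in aff_pts, v \in aff_pts, u != v & u + (v - u) * c \in aff_pts].
Proof.
rewrite mem_filter andbC !andbA; congr (_ && _).
rewrite !inE !xpair_eqE.
have [c0 c1] := (negbTE c_neq0, negbTE c_neq1).
have [c0' c1' o o'] : [/\ (0 == c) = false, (1 == c) = false, (1 == 0 :> D) = false
  & (0 == 1 :> D) = false] by rewrite [0 == c]eq_sym [1 == c]eq_sym [0 == 1]eq_sym c0 c1 oner_eq0.
have [->|u0] := eqVneq u 0.
  rewrite c0' o' /= !orbF [0 == v]eq_sym.
  by case: (eqVneq v 0) => [->|_]; rewrite ?o' ?c0' /= ?andbT.
have [->|u1] := eqVneq u 1.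
  rewrite c1' /= !orbF [1 == v]eq_sym.
  by case: (eqVneq v 1) => [->|_]; rewrite ?o ?c1' /= ?andbT ?andbF.
have [->|//] := eqVneq u c; rewrite /= [c == v]eq_sym.
by case: (eqVneq v c) => [->|_]; rewrite ?c0 ?c1 /= ?andbT ?orbF.
Qed.

Lemma aff_unit u v : v - u \is a GRing.unit -> (v - u) * 1 - u * 0 \is a GRing.unit.
Proof. by rewrite mulr1 mulr0 subr0. Qed.

Lemma act_aff u v (U : v - u \is a GRing.unit) x :
  to (pt x) (coset_gl2 (aff_unit U)) = pt (u + (v - u) * x).
Proof. by apply: act_gl2_eq; rewrite ?admissible_pair1r //; ring. Qed.

Lemma act_aff_infty u v (U : v - u \is a GRing.unit) :
  to infty (coset_gl2 (aff_unit U)) = infty.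
Proof. by apply: act_gl2_eq; rewrite ?admissible_pair1l //; ring. Qed.

(** By sharpness, an element fixing infinity is determined by the images of 0 and 1, which yields a
    bijection with [affine_pairs]. *)
Lemma card_tetrad_stab_infty :
  #|'C_('N(tetrad | to))[infty | to]%g| = size affine_pairs.
Proof.
pose f g := (to (pt 0) g, to (pt 1) g).
have CG g : g \in 'C_('N(tetrad | to))[infty | to]%g ->
    [/\ g \in G, g \in 'N(tetrad | to)%g & to infty g = infty].
  by case/setIP => gN gC; rewrite (astabs_dom gN) gN (astab_act gC) ?inE.
have tr := base_frame_transversal F.
rewrite -(card_in_imset (f := f)); last first.
  move=> g h /CG[gG _ gi] /CG[hG _ hi] [e0 e1].
  apply: (sharp_inj (@base_frame_trans F) (@base_frame_free F) tr gG hG).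
  by rewrite /= gi hi e0 e1.
have pp_uniq : uniq affine_pairs.
  rewrite filter_uniq // /= !inE !xpair_eqE !eqxx /=.
  have [c0 c1] := (negbTE c_neq0, negbTE c_neq1).
  by rewrite [0 == c]eq_sym [1 == c]eq_sym [0 == 1]eq_sym c0 c1 oner_eq0.
pose h (uv : D * D) := (pt uv.1, pt uv.2).
have h_inj : injective h.
  by move=> [u v] [u' v'] [/(@hpoint_inj1 F) -> /(@hpoint_inj1 F) ->].
rewrite -(size_map h) -(card_uniqP _) ?map_inj_uniq //; apply: eq_card => z.
apply/imsetP/mapP => [[g /CG[gG gN gi] ->]|[[u v] + ->]].
  have aff x : x \in aff_pts -> exists2 u, u \in aff_pts & to (pt x) g = pt u.
    rewrite -mem_tetrad -(astabs_act _ gN) => /setU1P[|/imsetP[u us ->]]; last by exists u.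
    rewrite -[RHS]gi => /act_inj/eqP; by rewrite hpoint_neq_infty.
  have [|u us e0] := aff 0; first by rewrite !inE eqxx.
  have [|v vs e1] := aff 1; first by rewrite !inE eqxx orbT.
  have [|w ws ec] := aff c; first by rewrite !inE eqxx !orbT.
  have uv : u != v.
    apply: contraTneq (oner_neq0 D) => uv; rewrite negbK; apply/eqP.
    by apply: (@hpoint_inj1 F); apply: (act_inj to g); rewrite e0 e1 uv.
  have U := aff_pts_diff us vs uv.
  (* Both elements agree on infinity, 0 and 1. *)
  have eg : g = coset_gl2 (aff_unit U).
    apply: (sharp_inj (@base_frame_trans F) (@base_frame_free F) tr gG).
      exact: mem_projective_group.
    rewrite /= gi act_aff_infty e0 e1 !act_aff mulr0 addr0 mulr1.
    by rewrite addrC subrK.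
  exists (u, v); last by rewrite /f e0 e1.
  rewrite mem_affine_pairs us vs uv /=.
  by move: ec; rewrite eg act_aff => /(@hpoint_inj1 F) ->.
rewrite mem_affine_pairs => /and4P[us vs uv ws].
have U := aff_pts_diff us vs uv.
have e0 : u + (v - u) * 0 = u by rewrite mulr0 addr0.
have e1 : u + (v - u) * 1 = v by rewrite mulr1 addrC subrK.
exists (coset_gl2 (aff_unit U)); last by rewrite /f !act_aff e0 e1.
apply/setIP; split.
  apply: tetrad_astabs; first exact: mem_projective_group.
  move=> P /setU1P[->|/imsetP[x xs ->]]; first by rewrite act_aff_infty mem_tetrad_infty.
  by rewrite act_aff mem_tetrad; case: (aff_ptsP xs) => ->; rewrite ?e0 ?e1.
rewrite inE mem_projective_group /= inE; apply/subsetP => P; rewrite !inE => /eqP ->.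
by rewrite act_aff_infty.
Qed.

Lemma card_tetrad_astabs : #|'N(tetrad | to)%g| = (4 * size affine_pairs)%N.
Proof.
have sNG : 'N(tetrad | to)%g \subset G by apply: subsetIl.
by rewrite -(card_orbit_in_stab to infty sNG) tetrad_trans card_tetrad card_tetrad_stab_infty.
Qed.

(* The six summands are the affine permutations of 0, 1, c: the identity, the
   three transpositions and the two 3-cycles. *)
Lemma size_affine_pairs : size affine_pairs =
  (1 + (c + 1 == 0)%R + (c + c - 1 == 0)%R + (c - 2 == 0)%R
   + 2 * (c ^+ 2 - c + 1 == 0)%R)%N.
Proof.
have mem3 x : (x \in aff_pts) = [|| x == 0, x == 1 | x == c] by rewrite !inE.
(* Each difference below factors as a unit times [y], and only [y] decides whether it vanishes; [y]
   equal to 1 or -1 marks an equation that never holds. *)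
have eqU a b e y : a \is a GRing.unit -> b - e = a * y -> (b == e) = (y == 0).
  by move=> ua eb; rewrite -subr_eq0 eb -[in RHS](inj_eq (mulrI ua)) mulr0.
have ucc1 : c * (c - 1) \is a GRing.unit by rewrite unitrM c_unit c1_unit.
have uc2 : (c - 1) ^+ 2 \is a GRing.unit by rewrite unitrX.
have one0 := oner_eq0 D.
have m1 : 0 + (1 - 0) * c \in aff_pts.
  by rewrite mem3 add0r subr0 mul1r eqxx !orbT.
have m2 : (0 + (c - 0) * c \in aff_pts) = (c + 1 == 0).
  rewrite mem3 (eqU (c * c) _ _ 1) ?unitrM ?c_unit //; last ring.
  rewrite (eqU (c - 1) _ 1 (c + 1)) //; last ring.
  rewrite (eqU (c * (c - 1)) _ c 1) //; last ring.
  by rewrite one0 orbF.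
have m3 : (1 + (0 - 1) * c \in aff_pts) = (c + c - 1 == 0).
  rewrite mem3 (eqU (c - 1) _ 0 (-1)) //; last ring.
  rewrite (eqU c _ 1 (-1)) //; last ring.
  rewrite (eqU (-1) _ c (c + c - 1)) ?unitrN ?unitr1 //; last ring.
  by rewrite oppr_eq0 one0.
have m4 : (1 + (c - 1) * c \in aff_pts) = (c ^+ 2 - c + 1 == 0).
  rewrite mem3 (eqU 1 _ 0 (c ^+ 2 - c + 1)) ?unitr1 //; last ring.
  rewrite (eqU (c * (c - 1)) _ 1 1) //; last ring.
  rewrite (eqU ((c - 1) ^+ 2) _ c 1) //; last ring.
  by rewrite one0 !orbF.
have m5 : (c + (0 - c) * c \in aff_pts) = (c ^+ 2 - c + 1 == 0).
  rewrite mem3 (eqU (c * (c - 1)) _ 0 (-1)) //; last ring.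
  rewrite (eqU (-1) _ 1 (c ^+ 2 - c + 1)) ?unitrN ?unitr1 //; last ring.
  rewrite (eqU (c * c) _ c (-1)) ?unitrM ?c_unit //; last ring.
  by rewrite oppr_eq0 one0 orbF.
have m6 : (c + (1 - c) * c \in aff_pts) = (c - 2 == 0).
  rewrite mem3 (eqU (- c) _ 0 (c - 2)) ?unitrN //; last ring.
  rewrite (eqU ((c - 1) ^+ 2) _ 1 (-1)) //; last ring.
  rewrite (eqU (c * (c - 1)) _ c (-1)) //; last ring.
  by rewrite oppr_eq0 one0 !orbF.
have count6 (T : Type) (p : pred T) (x1 x2 x3 x4 x5 x6 : T) :
  count p [:: x1; x2; x3; x4; x5; x6] = (p x1 + (p x2 + (p x3 + (p x4 + (p x5 + (p x6 + 0))))))%N by [].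
rewrite size_filter count6 [in LHS]/fst [in LHS]/snd.
rewrite m1 m2 m3 m4 m5 m6.
by case: (c + 1 == 0); case: (c + c - 1 == 0); case: (c - 2 == 0); case: (c ^+ 2 - c + 1 == 0).
Qed.

End Tetrad.

(** * The subline over a subfield *)

Section DualEmbedding.
Variable F : finFieldType.
Local Notation D := (dual_ring F).

Definition dual_of (x : F) : D := Dual x 0.

Lemma dual_of_is_zmod_morphism : zmod_morphism dual_of.
Proof. by move=> x y; congr Dual; rewrite /= subr0. Qed.

Lemma dual_of_is_monoid_morphism : monoid_morphism dual_of.
Proof. by split=> // x y; congr Dual; rewrite /= mulr0 mul0r addr0. Qed.

HB.instance Definition _ :=
  GRing.isZmodMorphism.Build F D dual_of dual_of_is_zmod_morphism.
HB.instance Definition _ :=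
  GRing.isMonoidMorphism.Build F D dual_of dual_of_is_monoid_morphism.

Lemma dual_of_inj : injective dual_of.
Proof. by move=> x y []. Qed.

Lemma dual_of_unit x : (dual_of x \is a GRing.unit) = (x != 0).
Proof. by rewrite dual_unitE. Qed.

End DualEmbedding.

(** * The subfield of order p^i and the designs from its subline *)

Section Subfield.
Variables (p n i : nat) (F : finFieldType).
Hypothesis p_prime : prime p.
Hypothesis n_gt0 : (0 < n)%N.
Hypothesis i_dvd_n : (i %| n)%N.
Hypothesis card_F : #|F| = (p ^ n)%N.
Local Notation D := (dual_ring F).
Local Notation m := (p ^ i)%N.

Definition fixed_field : {set F} := [set x | x ^+ m == x].

Lemma m_gt1 : (1 < m)%N.
Proof.
by rewrite -(exp1n i) ltn_exp2r ?prime_gt1 // (dvdn_gt0 n_gt0).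
Qed.

(** Induction: the new difference is the sum of two terms, a difference of m-th powers, divisible by
    ['X^(m ^ j) - 'X], and ['X^m - 'X] itself. *)
Lemma XmsubX_dvd j : ('X^m - 'X : {poly F}) %| 'X^(m ^ j) - 'X.
Proof.
elim: j => [|j IH]; first by rewrite expn0 expr1 subrr dvdp0.
have -> : 'X^(m ^ j.+1) - 'X = ('X^(m ^ j)) ^+ m - 'X^m + ('X^m - 'X) :> {poly F}.
  by rewrite -exprM -expnSr addrA subrK.
by rewrite dvdp_add // subrXX dvdp_mulr.
Qed.

(** ['X^m - 'X] divides the product of all ['X - x%:P], which has distinct linear factors, so it has
    as many roots in [F] as its degree. *)
Lemma card_fixed_field : #|fixed_field| = m.
Proof.
have dv : ('X^m - 'X : {poly F}) %| \prod_(x : F) ('X - x%:P).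
  rewrite -finField_genPoly card_F -(divnK i_dvd_n) mulnC expnM.
  exact: XmsubX_dvd.
have [b eb] := dvdp_prod_XsubC dv.
set r := mask b _ in eb.
have ur : uniq r by rewrite mask_uniq // index_enum_uniq.
have szr : size r = m.
  apply: succn_inj; rewrite -(size_prod_XsubC r id) -(eqp_size eb).
  by rewrite size_polyDl size_polyXn // size_polyN size_polyX ltnS m_gt1.
rewrite -szr -(card_uniqP ur); apply: eq_card => x.
rewrite inE -(root_prod_XsubC r) -(eqp_root eb) rootE !hornerE subr_eq0.
by [].
Qed.

Definition dual_subfield : {set D} := [set dual_of x | x in fixed_field].

Lemma fixed_field1 : 1 \in fixed_field.
Proof. by rewrite inE expr1n. Qed.

Lemma fixed_fieldM : {in fixed_field &, forall x y, x * y \in fixed_field}.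
Proof. by move=> x y; rewrite !inE exprMn => /eqP-> /eqP->. Qed.

Lemma fixed_fieldV : {in fixed_field, forall x, x^-1 \in fixed_field}.
Proof. by move=> x; rewrite !inE exprVn => /eqP->. Qed.

(** [m] is a power of the characteristic, so raising to the power [m] is additive. *)
Lemma fixed_fieldB : {in fixed_field &, forall x y, x - y \in fixed_field}.
Proof.
have pF : [pchar F].-nat m.
  by rewrite pnatX pnatE // (card_finPcharP card_F).
move=> x y; rewrite !inE => /eqP ex /eqP ey.
by rewrite exprDn_pchar // exprNn_pchar // ex ey.
Qed.

Definition fixed_subline : {set point F} := subline dual_subfield.

Lemma dual_subfield1 : 1 \in dual_subfield.
Proof. by rewrite -(rmorph1 (@dual_of F)) imset_f // fixed_field1. Qed.

Lemma dual_subfieldB : {in dual_subfield &, forall a b, a - b \in dual_subfield}.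
Proof.
by move=> _ _ /imsetP[x xK ->] /imsetP[y yK ->]; rewrite -rmorphB imset_f // fixed_fieldB.
Qed.

Lemma dual_subfieldM : {in dual_subfield &, forall a b, a * b \in dual_subfield}.
Proof.
by move=> _ _ /imsetP[x xK ->] /imsetP[y yK ->]; rewrite -rmorphM imset_f // fixed_fieldM.
Qed.

Lemma dual_subfieldU : {in dual_subfield, forall a, a != 0 -> a \is a GRing.unit}.
Proof.
move=> _ /imsetP[x xK ->]; rewrite dual_of_unit; apply: contra => /eqP ->.
by rewrite rmorph0.
Qed.

Lemma dual_subfieldV : {in dual_subfield, forall a, a^-1 \in dual_subfield}.
Proof.
by move=> _ /imsetP[x xK ->]; rewrite -fmorphV imset_f // fixed_fieldV.
Qed.

Lemma card_fixed_subline : #|fixed_subline| = (m + 1)%N.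
Proof.
by rewrite card_subline (card_imset _ (@dual_of_inj F)) card_fixed_field.
Qed.

Lemma fixed_subline_circle :
  circle (@parallel F) (projective_action F) fixed_subline.
Proof.
exact: (subline_circle dual_subfield1 dual_subfieldB dual_subfieldM
          dual_subfieldV dual_subfieldU).
Qed.

Lemma transversal_fixed_subline (S : {set point F}) : S \subset fixed_subline ->
  transversal_set (@parallel F) S.
Proof.
by move=> SL; have [trL _] := fixed_subline_circle;
  apply: (transversal_setS (@parallel_equiv F) SL).
Qed.

(** The block is the subline without [j] of its points; its stabiliser has order [(m + 1) ^_ 3]
    divided by ['C(m + 1, j)]. *)
Lemma subline_design j : (j <= 3)%N -> (2 < m + 1 - j)%N ->
  exists_projective_design F (m + 1 - j)
    (((m + 1 - j) ^_ 3)%N%:R * 'C(m + 1, j)%:R / ((m + 1) ^_ 3)%N%:R).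
Proof.
move=> j3 k3; have cL := fixed_subline_circle; have eL := card_fixed_subline.
have [T TL cT] : exists2 T : {set point F}, T \subset fixed_subline & #|T| = j.
  have: (0 < #|[set A : {set point F} | A \subset fixed_subline & #|A| == j]|)%N.
    by rewrite cards_draws eL bin_gt0; lia.
  by case/card_gt0P => T; rewrite inE => /andP[TL /eqP]; exists T.
have cS : #|fixed_subline :\: T| = (m + 1 - j)%N.
  by rewrite cardsD (setIidPr TL) eL cT.
have S3 : (2 < #|fixed_subline :\: T|)%N by rewrite cS.
have := block_design (transversal_fixed_subline (subsetDl _ T)) S3.
rewrite (circle_astabsD cL TL S3) cS.
have b0 : 'C(m + 1, j)%:R != 0 :> rat by rewrite pnatr_eq0 -lt0n bin_gt0; lia.
have L3 : (#|T| <= 3 <= #|fixed_subline|)%N by rewrite cT eL j3; lia.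
have := card_circle_astabsI (@parallel_equiv F) (@parallel_act F)
  (@base_frame_trans F) (@base_frame_free F) cL TL L3.
by rewrite cT eL => <-; rewrite natrM -mulf_div divff // mulr1.
Qed.

Section TetradDesigns.
Variable a : F.
Hypothesis aK : a \in fixed_field.
Hypothesis a_neq0 : a != 0.
Hypothesis a_neq1 : a != 1.
Hypothesis m_gt5 : (5 < m)%N.

(** Here [s] is the number of affine permutations of 0, 1, a. Both blocks, the four-set and its
    complement in the subline, have the same stabiliser of order [4 * s], and 24 is [4 ^_ 3]. *)
Lemma tetrad_designs s :
  (1 + (a + 1 == 0)%R + (a + a - 1 == 0)%R + (a - 2 == 0)%R
   + 2 * (a ^+ 2 - a + 1 == 0)%R)%N = s ->
  exists_projective_design F (m - 3) (((m - 3) ^_ 3)%N%:R / (4 * s)%N%:R) /\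
  exists_projective_design F 4 (24%:R / (4 * s)%N%:R).
Proof.
move=> es; have ua : dual_of a \is a GRing.unit by rewrite dual_of_unit.
have ua1 : dual_of a - 1 \is a GRing.unit.
  by rewrite -(rmorph1 (@dual_of F)) -rmorphB dual_of_unit subr_eq0.
have cL := fixed_subline_circle; have eL := card_fixed_subline.
have TL : tetrad (dual_of a) \subset fixed_subline.
  apply/subsetP => P /setU1P[->|/imsetP[x xs ->]]; first by rewrite !inE eqxx.
  apply/setU1P; right; apply: imset_f.
  case: (aff_ptsP xs) => ->; last exact: imset_f.
    by rewrite -(rmorph0 (@dual_of F)) imset_f // -(subrr 1) fixed_fieldB ?fixed_field1.
  exact: dual_subfield1.
have cT := card_tetrad ua ua1.
have cN : #|'N(tetrad (dual_of a) | projective_action F)%g| = (4 * s)%N.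
  rewrite card_tetrad_astabs // size_affine_pairs // -es.
  have eqD (x : D) (y : F) : x = dual_of y -> (x == 0) = (y == 0).
    by move=> ->; rewrite -(rmorph0 (@dual_of F)) (inj_eq (@dual_of_inj F)).
  rewrite (eqD _ (a + 1)) ?rmorphD ?rmorph1 //.
  rewrite (eqD _ (a + a - 1)) ?rmorphB ?rmorphD ?rmorph1 //.
  rewrite (eqD _ (a - 2)) ?rmorphB ?rmorph_nat //.
  rewrite (eqD _ (a ^+ 2 - a + 1)); first by [].
  by rewrite rmorphD rmorphB rmorphXn rmorph1.
have T3 : (2 < #|tetrad (dual_of a)|)%N by rewrite cT.
have cS : #|fixed_subline :\: tetrad (dual_of a)| = (m - 3)%N.
  by rewrite cardsD (setIidPr TL) eL cT addn1 subSS.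
have S3 : (2 < #|fixed_subline :\: tetrad (dual_of a)|)%N by rewrite cS ltn_subRL.
split.
  have := block_design (transversal_fixed_subline (subsetDl _ (tetrad (dual_of a)))) S3.
  rewrite (circle_astabsD cL TL S3) (setIidPr _) ?cN ?cS //.
  exact: circle_astabs_sub cL TL T3.
by have := block_design (transversal_fixed_subline TL) T3; rewrite cN cT.
Qed.
End TetradDesigns.
End Subfield.

(** * Choice of the fourth point *)

Section TetradParameters.
Variables (p n i : nat) (F : finFieldType).
Hypothesis p_prime : prime p.
Hypothesis n_gt0 : (0 < n)%N.
Hypothesis i_dvd_n : (i %| n)%N.
Hypothesis card_F : #|F| = (p ^ n)%N.
Local Notation m := (p ^ i)%N.
Local Notation K := (fixed_field p i F).

Lemma card_field_natr_eq0 k : (k%:R == 0 :> F) = (p %| k)%N.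
Proof. by rewrite -(dvdn_pcharf (card_finPcharP card_F p_prime)). Qed.

(** At most seven values are excluded: 0, 1, the roots of the three linear conditions, and the at
    most two roots [b] and [1 - b] of the quadratic one. *)
Lemma generic_parameter : (7 < m)%N -> exists2 a : F, a \in K &
  [/\ a != 0, a != 1 &
      [/\ a + 1 != 0, a + a - 1 != 0, a - 2 != 0 & a ^+ 2 - a + 1 != 0]].
Proof.
(* The default 0 only occurs when the quadratic has no root; then [b] and [1 - b] are 0 and 1, which
   are excluded anyway. *)
move=> m7; pose b : F := odflt 0 [pick b : F | b ^+ 2 - b + 1 == 0].
pose bad : seq F := [:: 0; 1; -1; 2^-1; 2; b; 1 - b].
have [a aK] : exists2 a, a \in K & a \notin bad.
  apply/exists_inP; rewrite -negb_forall_in; apply: contraTN m7 => /forall_inP h.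
  rewrite -leqNgt -(card_fixed_field p_prime n_gt0 i_dvd_n card_F) cardE.
  by apply: (uniq_leq_size (enum_uniq _) (s2 := bad)) => x; rewrite mem_enum => /h.
rewrite !inE !negb_or => /and5P[a0 a1 aN1 ah /and3P[a2 ab ab']].
exists a; rewrite // a0 a1; split=> //; split.
- by rewrite addr_eq0.
(* In characteristic 2 the entry [2^-1] is the junk value 0, but the equation [a + a = 1] itself
   forces 2 to be nonzero. *)
- apply: contra ah => /eqP e; have e2 : a * 2 = 1 by rewrite mulr_natr mulr2n; apply/eqP; rewrite -subr_eq0 e.
  have two0 : (2 : F) != 0 by apply: contra_eq_neq e2 => ->; rewrite mulr0 eq_sym oner_eq0.
  by rewrite -(mulfK two0 a) e2 mul1r.
- by rewrite subr_eq0.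
- apply/negP => ea; have: (a - b) * (a - (1 - b)) == 0; last first.
    by rewrite mulf_eq0 !subr_eq0 (negbTE ab) (negbTE ab').
  have eb : b ^+ 2 - b + 1 = 0.
    by rewrite /b; case: pickP => [x /eqP //|/(_ a)]; rewrite ea.
  have -> : (a - b) * (a - (1 - b)) = (a ^+ 2 - a + 1) - (b ^+ 2 - b + 1) by ring.
  by rewrite (eqP ea) eb subrr.
Qed.

Lemma fixed_field_opp1 : -1 \in K.
Proof.
have fB := @fixed_fieldB p n i F p_prime card_F.
by rewrite -[-1]sub0r fB ?fixed_field1 // -(subrr 1) fB ?fixed_field1.
Qed.

(* A sixth root of unity is minus a cube root of unity, obtained as
   the ((m - 1) / 3)-th power of a unit on which that power is not trivial. *)
Lemma sixth_root_parameter : m = 1 %[mod 3] ->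
  exists2 a : F, a \in K & a ^+ 2 - a + 1 == 0.
Proof.
move=> m1; have m_gt1 := m_gt1 p_prime n_gt0 i_dvd_n; set e := (m.-1 %/ 3)%N.
have em : (e * 3)%N = m.-1.
  by rewrite divnK // -subn1 -eqn_mod_dvd ?(ltnW m_gt1) //; apply/eqP.
have e0 : (0 < e)%N by case: (posnP e) em => // ->; lia.
(* Otherwise the [m - 1] nonzero elements of [K] would all be roots of unity of order dividing [e],
   a third of [m - 1]. *)
have [x xK /andP[x0 xe]] : exists2 x : F, x \in K & (x != 0) && (x ^+ e != 1).
  apply/exists_inP; rewrite -[[exists _ in _, _]]negbK negb_exists_in.
  apply/negP => /forall_inP h.
  have cK := card_fixed_field p_prime n_gt0 i_dvd_n card_F.
  have: (#|K :\ (0%R : F)| <= e)%N.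
    rewrite cardE; apply: (@max_unity_roots F) => //; last exact: enum_uniq.
    apply/allP => x; rewrite mem_enum !inE => /andP[x0 xK].
    by have := h x; rewrite inE xK x0 negbK unity_rootE => ->.
  have := cardsD1 (0%R : F) K; rewrite cK inE expr0n gtn_eqF ?(ltnW m_gt1) // eqxx.
  lia.
have xm : x ^+ m.-1 = 1.
  apply: (mulfI x0); rewrite -exprS prednK ?(ltnW m_gt1) // mulr1.
  by move: xK; rewrite inE => /eqP.
have ew : (x ^+ e) ^+ 2 + x ^+ e + 1 = 0.
  have: (x ^+ e - 1) * ((x ^+ e) ^+ 2 + x ^+ e + 1) = 0.
    have -> : (x ^+ e - 1) * ((x ^+ e) ^+ 2 + x ^+ e + 1) = (x ^+ e) ^+ 3 - 1 by ring.
    by rewrite -exprM em xm subrr.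
  by move/eqP; rewrite mulf_eq0 subr_eq0 (negbTE xe) => /eqP.
exists (- x ^+ e); last by rewrite sqrrN opprK ew.
have xeK : x ^+ e \in K by move: xK; rewrite !inE exprAC => /eqP ->.
have fM := @fixed_fieldM p i F.
by rewrite -mulN1r fM // fixed_field_opp1.
Qed.

End TetradParameters.

(** * Parameters as rational numbers, and the list of designs *)

Lemma natr_ffact3 (k : nat) : (k ^_ 3)%N%:R = k%:R * (k%:R - 1) * (k%:R - 2) :> rat.
Proof.
case: k => [|[|[|k]]]; rewrite ?mul0r ?subrr ?mulr0 ?mul0r //.
rewrite !ffactnS ffactn0 /= muln1 !natrM -!natr1; ring.
Qed.

Lemma natr_bin2 (k : nat) : 'C(k, 2)%:R = k%:R * (k%:R - 1) / 2 :> rat.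
Proof.
have -> : k%:R * (k%:R - 1) = (k ^_ 2)%N%:R :> rat.
  case: k => [|k]; first by rewrite mul0r.
  by rewrite !ffactnS ffactn0 muln1 natrM -natr1 addrK.
by rewrite -bin_ffact natrM mulfK.
Qed.

Lemma natr_bin3 (k : nat) :
  'C(k, 3)%:R = k%:R * (k%:R - 1) * (k%:R - 2) / 6 :> rat.
Proof.
by rewrite -natr_ffact3 -bin_ffact natrM mulfK.
Qed.

(** The parameters of [subline_design] for one, two and three removed points, with [r] for the order
    of the subfield. *)
Lemma subline_lambdas (r : rat) : 1 < r ->
  let d := (r + 1) * (r + 1 - 1) * (r + 1 - 2) in
  [/\ r * (r - 1) * (r - 2) * (r + 1) / d = r - 2,
      (r - 1) * (r - 1 - 1) * (r - 1 - 2) * ((r + 1) * (r + 1 - 1) / 2) / d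
      = 1 / 2 * (r - 2) * (r - 3)
    & (r - 2) * (r - 2 - 1) * (r - 2 - 2)
        * ((r + 1) * (r + 1 - 1) * (r + 1 - 2) / 6) / d
      = 1 / 6 * (r - 2) * (r - 3) * (r - 4)].
Proof.
move=> r1; have r0 : 0 < r := lt_trans ltr01 r1.
have nz : [&& r + 1 - 2 != 0, r + 1 - 1 != 0 & r + 1 != 0].
  have -> : r + 1 - 2 = r - 1 by ring.
  by rewrite addrK subr_eq0 (gt_eqF r1) (gt_eqF r0) gt_eqF // addr_gt0.
by split; field.
Qed.

Theorem theorem3p1p1 (p n i : nat) (F : finFieldType)
    (p_prime : prime p) (n_gt0 : (0 < n)%N) (i_dvd_n : (i %| n)%N)
    (card_F : #|F| = (p ^ n)%N) :
  let m := (p ^ i)%N in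
  let r : rat := m%:R in
  #|point F| = (p ^ n * (p ^ n + 1))%N /\
  exists_projective_design F (m + 1) 1 /\
  ((2 < m)%N -> exists_projective_design F m (r - 2)) /\
  ((3 < m)%N ->
    exists_projective_design F (m - 1) (1 / 2 * (r - 2) * (r - 3))) /\
  ((4 < m)%N ->
    exists_projective_design F (m - 2) (1 / 6 * (r - 2) * (r - 3) * (r - 4))) /\
  ((7 < m)%N ->
    exists_projective_design F (m - 3) (1 / 4 * (r - 3) * (r - 4) * (r - 5)) /\
    exists_projective_design F 4 6) /\
  (p = 3%N -> (5 < m)%N ->
    exists_projective_design F (m - 3) (1 / 24 * (r - 3) * (r - 4) * (r - 5)) /\
    exists_projective_design F 4 1) /\
  ((3 < p)%N -> (5 < m)%N ->
    exists_projective_design F (m - 3) (1 / 8 * (r - 3) * (r - 4) * (r - 5)) /\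
    exists_projective_design F 4 3) /\
  (m = 1 %[mod 3] -> (5 < m)%N ->
    exists_projective_design F (m - 3) (1 / 12 * (r - 3) * (r - 4) * (r - 5)) /\
    exists_projective_design F 4 2).
Proof.
move=> m r; have m1 : (1 < m)%N := m_gt1 p_prime n_gt0 i_dvd_n.
have row := @subline_design p n i F p_prime n_gt0 i_dvd_n card_F; rewrite -/m in row.
have tet := @tetrad_designs p n i F p_prime n_gt0 i_dvd_n card_F; rewrite -/m in tet.
(* [d] is the order of the stabiliser of the four-set and [l] the parameter of the design with
   [k = 4]. *)
have tet' (a : F) (s d l : nat) : (4 * s)%N = d -> (l * d)%N = 24%N ->
  a \in fixed_field p i F -> a != 0 -> a != 1 -> (5 < m)%N ->
  (1 + (a + 1 == 0)%R + (a + a - 1 == 0)%R + (a - 2 == 0)%R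
   + 2 * (a ^+ 2 - a + 1 == 0)%R)%N = s ->
  exists_projective_design F (m - 3)
    (1 / d%:R * (r - 3) * (r - 4) * (r - 5)) /\
  exists_projective_design F 4 l%:R.
  move=> es el aK a0 a1 m5 /(tet a aK a0 a1 m5); rewrite es -el natrM => -[h1 h2].
  have d0 : d%:R != 0 :> rat.
    by rewrite pnatr_eq0; apply: contra_eq_neq el => ->; rewrite muln0.
  split; last by rewrite mulfK in h2.
  move: h1; rewrite natr_ffact3 natrB -/r; last by lia.
  by congr (exists_projective_design F _ _); ring.
have natr0 := card_field_natr_eq0 p_prime card_F.
have r1 : 1 < r by rewrite /r ltr1n.
have [lam1 lam2 lam3] := subline_lambdas r1.
have em1 : (m + 1)%N%:R = r + 1 :> rat by rewrite natrD.
split; first by rewrite card_point card_F.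
split; [|split; [|split; [|split; [|split; [|split; [|split]]]]]].
- have := row 0 isT; rewrite subn0 bin0 => /(_ _); rewrite mulr1 divff.
    by apply; lia.
  by rewrite pnatr_eq0 -lt0n ffact_gt0; lia.
- move=> m2; have := row 1 isT; rewrite addnK bin1 !natr_ffact3 em1 -/r => /(_ m2).
  by rewrite lam1.
- move=> m3; have := row 2 isT; have -> : (m + 1 - 2 = m - 1)%N by lia.
  rewrite natr_bin2 !natr_ffact3 em1 natrB; last by lia.
  rewrite -/r => /(_ _) h; move: (h ltac:(lia)).
  by rewrite lam2.
- move=> m4; have := row 3 isT; have -> : (m + 1 - 3 = m - 2)%N by lia.
  rewrite natr_bin3 !natr_ffact3 em1 natrB; last by lia.
  rewrite -/r => /(_ _) h; move: (h ltac:(lia)).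
  by rewrite lam3.
- move=> m7; have [a aK [a0 a1 [b1 b2 b3 b4]]] :=
    generic_parameter p_prime n_gt0 i_dvd_n card_F m7.
  apply: (tet' a 1 4 6)%N => //; first exact: ltn_trans m7.
  by rewrite (negbTE b1) (negbTE b2) (negbTE b3) (negbTE b4).
- move=> p3 m5; have e3 : (3 : F) = 0 by apply/eqP; rewrite natr0 p3.
  (* In characteristic 3, -1 satisfies all four equations, so all six permutations of 0, 1, -1 are
     affine. *)
  apply: (tet' (-1)%R 6 24 1)%N => //.
  + exact: (@fixed_field_opp1 p n i).
  + by rewrite oppr_eq0 oner_eq0.
  + by rewrite -subr_eq0 -opprD oppr_eq0 -mulr2n natr0 p3.
  + rewrite addNr (_ : -1 - 1 - 1 = - 3); last ring.
    rewrite (_ : -1 - 2 = - 3); last ring.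
    by rewrite (_ : (-1) ^+ 2 - -1 + 1 = 3); [rewrite e3 oppr0 eqxx | ring].
- move=> p3 m5; have ne k : (0 < k)%N -> (k < p)%N -> (k%:R == 0 :> F) = false.
    by move=> k0 kp; rewrite natr0 gtnNdvd.
  (* In characteristic above 3 only [a + 1 = 0] holds for -1: the other three expressions are 3 or
     -3. *)
  apply: (tet' (-1)%R 2 8 3)%N => //.
  + exact: (@fixed_field_opp1 p n i).
  + by rewrite oppr_eq0 oner_eq0.
  + by rewrite -subr_eq0 -opprD oppr_eq0 -mulr2n ne // ltnW.
  + rewrite addNr (_ : -1 - 1 - 1 = - 3); last ring.
    rewrite (_ : -1 - 2 = - 3); last ring.
    rewrite (_ : (-1) ^+ 2 - -1 + 1 = 3); last ring.
    by rewrite oppr_eq0 ne // eqxx.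
- move=> mm m5; have [a aK ea] := sixth_root_parameter p_prime n_gt0 i_dvd_n card_F mm.
  have e3 : (3 == 0 :> F) = false.
    rewrite natr0 (dvdn_prime2 p_prime) //; apply/eqP => p3.
    by move: mm; rewrite /m p3 -(prednK (dvdn_gt0 n_gt0 i_dvd_n)) expnS modnMr.
  (* These identities show that a root of the quadratic satisfies none of the linear equations when
     3 is nonzero; this leaves the identity and the two 3-cycles. *)
  have e1 : 3 = (a ^+ 2 - a + 1) - (a + 1) * (a - 2) by ring.
  have e2 : 3 = 4 * (a ^+ 2 - a + 1) - (a + a - 1) ^+ 2 by ring.
  rewrite (eqP ea) ?mulr0 ?sub0r in e1 e2.
  have : (a + 1) * (a - 2) != 0 by rewrite -oppr_eq0 -e1 e3.
  rewrite mulf_eq0 negb_or => /andP[/negbTE b1 /negbTE b3].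
  have : (a + a - 1) ^+ 2 != 0 by rewrite -oppr_eq0 -e2 e3.
  rewrite expf_eq0 /= => /negbTE b2.
  apply: (tet' a 3 12 2)%N => //.
  + by apply: contraTneq ea => ->; rewrite expr0n subrr add0r oner_eq0.
  + by apply: contraTneq ea => ->; rewrite expr1n subrr add0r oner_eq0.
  + by rewrite b1 b2 b3 ea.
Qed.
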